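(* Let $\mathcal E$ be a discrete asymmetric information economy with commodity space a Banach lattice $Y$ and let $\mathcal E_c$ be the associated continuum economy. Assume: (Continuity) for all $i\in N$, $\omega\in\Omega$, $U_i(\omega,\cdot)$ is norm-continuous on $Y_+$; (Monotonicity) for all $i\in N$, $\omega\in\Omega$, if $x,y\in Y_+$ and $y>0$ then $U_i(\omega,x+y)>U_i(\omega,x)$; (Concavity) for all $i\in N$, $\omega\in\Omega$, $U_i(\omega,\cdot)$ is concave; (Quasi-interiority) for each $\omega\in\Omega$, $\sum_{i\in N}a_i(\omega)$ is a quasi-interior point of $Y_+$; (Stability) there is $\hat a\in Y_+$ such that $L\left(\sum_{i\in N}a_i(\omega)\right)=L(\hat a)$ for each $\omega\in\Omega$; (Properness) if $(x_1,\dots,x_n)$ is a privately Pareto optimal allocation in $\mathcal E$, then for each $i\in N$ the preference relation $P_i$ is ATY-proper at $x_i$. Let $f$ be a feasible allocation in $\mathcal E_c$ such that $f(t,\cdot)=x_i$ for all $t\in I_i$ and $i\in N$. If $f$ is in the private core of $\mathcal E_c$, then $(f,\pi)$ is a non-trivial Walrasian expectations quasi-equilibrium of $\mathcal E_c$ for some non-zero $\pi:\Omega\to Y_+^*$.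
   Context: **Discrete economy.** $N=\{1,\dots,n\}$ is a finite set of agents; $(\Omega,\mathcal F)$ is a measurable space with $\Omega$ a finite set of states, the $\sigma$-algebra $\mathcal F$ being the set of all events; $Y$ is a Banach lattice with positive cone $Y_+$, norm dual $Y^*$, and positive dual cone $Y_+^*$. For $y\in Y$, $y>0$ means $y\ge 0$ and $y\neq 0$. The principal ideal of $y$ is $L(y)=\{z\in Y: |z|\le m|y| \text{ for some } m\in\mathbb N\}$; $y\in Y_+$ is a quasi-interior point of $Y_+$ if $L(y)$ is norm dense in $Y$. A discrete economy $\mathcal E$ consists, for each $i\in N$, of a partition $\mathcal F_i$ of $\Omega$ (private information), a random utility $U_i:\Omega\times Y_+\to\mathbb R$, a random initial endowment $a_i:\Omega\to Y_+$ that is constant on elements of $\mathcal F_i$, and a prior $q_i$, a probability measure on $\Omega$ with $q_i(\omega)>0$ for all $\omega$. The ex ante expected utility is $V_i(x)=\sum_{\omega\in\Omega}U_i(\omega,x(\omega))q_i(\omega)$ for $x:\Omega\to Y_+$. A function on $\Omega$ is called $\mathcal F_i$-measurable if it is constant on elements of $\mathcal F_i$ (measurability is meant with respect to the $\sigma$-algebra generated by the partition); $L_i=\{x\in (Y_+)^\Omega: x \text{ is } \mathcal F_i\text{-measurable}\}$. An allocation of $\mathcal E$ is $x=(x_1,\dots,x_n)$ with $x_i\in L_i$; it is feasible if $\sum_i x_i(\omega)\le\sum_i a_i(\omega)$ for all $\omega$. A feasible allocation $x$ is privately Pareto optimal if there is no feasible allocation $y$ with $V_i(y_i)>V_i(x_i)$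 for all $i\in N$. **Preferences.** For $x_i\in L_i$, $P_i(x_i)=\{y_i\in L_i:V_i(y_i)>V_i(x_i)\}$. $P_i$ is ATY-proper at $x_i\in L_i$ if there is a convex set $\widetilde P_i(x_i)\subseteq Y^\Omega$ with non-empty interior in the product norm topology of $Y^\Omega$ such that $\widetilde P_i(x_i)\cap L_i=P_i(x_i)$ and $(\operatorname{int}\widetilde P_i(x_i))\cap L_i\neq\emptyset$. **Price systems and budget sets.** A price system is an $\mathcal F$-measurable non-zero function $\pi:\Omega\to Y_+^*$, and $B_i(\pi)=\{x\in L_i:\sum_{\omega}\langle\pi(\omega),x(\omega)\rangle\le\sum_{\omega}\langle\pi(\omega),a_i(\omega)\rangle\}$. **Continuum economy $\mathcal E_c$.** The agent space is $I=[0,1]$ with Lebesgue measure $\mu$, $I_i=[\frac{i-1}{n},\frac in)$ for $i<n$ and $I_n=[\frac{n-1}{n},1]$. Each $t\in I_i$ has $L_t=L_i$, $a(t,\cdot)=a_i$, $V_t=V_i$, $B_t(\pi)=B_i(\pi)$. Integrals of $Y$-valued functions are Bochner integrals. An assignment is $f:I\times\Omega\to Y_+$ with $f(\cdot,\omega)$ Bochner integrable for every $\omega$; it is an allocation if $f(t,\cdot)\in L_t$ for almost all $t$; an allocation is feasible if $\int_I f(t,\omega)d\mu(t)\le\int_I a(t,\omega)d\mu(t)$ for all $\omega$. A coalition is a Borel measurable set $S\subseteq I$ with $\mu(S)>0$. It privately blocks an allocation $f$ if there is $g:S\times\Omega\to Y_+$ with $g(t,\cdot)\in L_t$ and $V_t(g(t,\cdot))>V_t(f(t,\cdot))$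 for all $t\in S$ and $\int_S g(t,\omega)d\mu(t)\le\int_S a(t,\omega)d\mu(t)$ for all $\omega$. The private core of $\mathcal E_c$ is the set of feasible allocations not privately blocked by any coalition. **Quasi-equilibrium of $\mathcal E_c$.** For a feasible allocation $f$ and price system $\pi$, $(f,\pi)$ is a Walrasian expectations quasi-equilibrium if (i) for all $t\in I$, $f(t,\cdot)\in B_t(\pi)$, and $f(t,\cdot)$ maximizes $V_t$ on $B_t(\pi)$ whenever $\sum_\omega\langle\pi(\omega),a(t,\omega)\rangle\ne 0$; and (ii) $\sum_\omega\langle\pi(\omega),\int_I f(t,\omega)d\mu(t)\rangle=\sum_\omega\langle\pi(\omega),\int_I a(t,\omega)d\mu(t)\rangle$. It is non-trivial if $\sum_\omega\langle\pi(\omega),a(t,\omega)\rangle\ne 0$ for all $t$ in some coalition. *)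

(* Defs.v *)
From HB Require Import structures.
From mathcomp Require Import all_boot all_order all_algebra.
From mathcomp Require Import all_classical all_reals all_analysis.

Set Implicit Arguments.
Unset Strict Implicit.
Unset Printing Implicit Defensive.

Import Order.TTheory GRing.Theory Num.Theory.
Import numFieldNormedType.Exports.

Local Open Scope classical_set_scope.
Local Open Scope ring_scope.

(* The order is part of the mixin, not inherited from Order.Lattice, because
   HB has no join of Order.Lattice and NormedModule below Num.RealDomain; it is
   made into an Order.Lattice (with ring_display, hence the notations of
   ring_scope) right after. *)
HB.mixin Record isBanachLattice (R : realType) Y & CompleteNormedModule R Y := {
  bl_le : rel Y;
  bl_meet : Y -> Y -> Y;
  bl_join : Y -> Y -> Y;
  bl_le_refl : reflexive bl_le;
  bl_le_anti : antisymmetric bl_le;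
  bl_le_trans : transitive bl_le;
  bl_lexI : forall x y z, bl_le x (bl_meet y z) = bl_le x y && bl_le x z;
  bl_leUx : forall x y z, bl_le (bl_join x y) z = bl_le x z && bl_le y z;
  bl_leD2r : forall x y z, bl_le x y -> bl_le (x + z) (y + z);
  bl_leZ : forall (a : R) x y, 0 <= a -> bl_le x y -> bl_le (a *: x) (a *: y);
  bl_norm_le : forall x y,
    bl_le (bl_join x (- x)) (bl_join y (- y)) -> `|x| <= `|y|
}.

#[short(type="banachLatticeType")]
HB.structure Definition BanachLattice (R : realType) :=
  {Y of CompleteNormedModule R Y & isBanachLattice R Y}.

#[non_forgetful_inheritance]
HB.instance Definition _ (R : realType) (Y : banachLatticeType R) :=
  Order.Le_isPOrder.Build ring_display (BanachLattice.sort Y)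
    bl_le_refl bl_le_anti bl_le_trans.
#[non_forgetful_inheritance]
HB.instance Definition _ (R : realType) (Y : banachLatticeType R) :=
  Order.POrder_isMeetSemilattice.Build ring_display (BanachLattice.sort Y)
    bl_lexI.
#[non_forgetful_inheritance]
HB.instance Definition _ (R : realType) (Y : banachLatticeType R) :=
  Order.POrder_isJoinSemilattice.Build ring_display (BanachLattice.sort Y)
    bl_leUx.

Section banach_lattice.
Context {R : realType} {Y : banachLatticeType R}.

(* The lattice absolute value; the notation `|y| is the norm. *)
Definition labs (y : Y) : Y := Order.join y (- y).

Definition pos_cone : set Y := [set y | 0 <= y].

Definition principal_ideal (y : Y) : set Y :=
  [set z | exists m : nat, labs z <= m%:R *: labs y].

Definition quasi_interior (y : Y) : Prop :=
  0 <= y /\ dense (principal_ideal y).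

(* Y_+^*: norm-continuous linear functionals that are positive on Y_+. *)
Definition pos_dual : set {linear Y -> R^o} :=
  [set p : {linear Y -> R^o} |
    continuous (p : Y -> R^o) /\ forall y : Y, 0 <= y -> (0 : R) <= p y].

End banach_lattice.
Arguments pos_cone {R} Y.
Arguments pos_dual {R} Y.

Definition concave_on {R : realType} {E : lmodType R} (D : set E) (u : E -> R) :=
  forall (x y : E) (l : R), D x -> D y -> 0 <= l <= 1 ->
    l * u x + (1 - l) * u y <= u (l *: x + (1 - l) *: y).

Section bochner.
Context {d : measure_display} {T : measurableType d} {R : realType}.
Context {Y : completeNormedModType R}.
Variable mu : {measure set T -> \bar R}.
Implicit Types (D : set T) (f : T -> Y).

Definition simple_on D (s : T -> Y) : Prop :=
  [/\ finite_set (s @` D),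
      forall y : Y, measurable (D `&` s @^-1` [set y]) &
      forall y : Y, y != 0 -> (mu (D `&` s @^-1` [set y]) < +oo)%E].

(* At y = 0 the level set may have infinite measure; that term vanishes. *)
Definition simple_integral D (s : T -> Y) : Y :=
  \sum_(y \in s @` D) fine (mu (D `&` s @^-1` [set y])) *: y.

Definition strongly_measurable_on D f : Prop :=
  exists s : nat -> T -> Y, (forall k, simple_on D (s k)) /\
    {ae mu, forall t, D t -> s k t @[k --> \oo] --> f t}.

Definition bochner_approx D f (s : nat -> T -> Y) : Prop :=
  (forall k, simple_on D (s k)) /\
  (\int[mu]_(t in D) `|f t - s k t|%:E)%E @[k --> \oo] --> 0%E.

Definition bochner_integrable D f : Prop :=
  strongly_measurable_on D f /\ exists s, bochner_approx D f s.

(* Junk value (the default point of Y) when f is not Bochner integrable. *)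
Definition bochner_integral D f : Y :=
  get [set v | exists2 s : nat -> T -> Y, bochner_approx D f s &
                 simple_integral D (s k) @[k --> \oo] --> v].

End bochner.

(* Agents are indexed by 'I_n.+1 (so there are n.+1 >= 1 of them).  Utilities
   are total on Y; only their values on Y_+ are ever used.  Every subset of the
   finite set Omega is an event, so F-measurability is no constraint. *)
Definition constant_on_cells {Omega : finType} {Z : Type}
    (P : {set {set Omega}}) (x : Omega -> Z) : Prop :=
  forall A, A \in P -> {in A &, forall w w', x w = x w'}.

Record economy (R : realType) (Y : banachLatticeType R) (Omega : finType)
    (n : nat) := Economy {
  info : 'I_n.+1 -> {set {set Omega}};
  util : 'I_n.+1 -> Omega -> Y -> R;
  endow : 'I_n.+1 -> Omega -> Y;
  prior : 'I_n.+1 -> Omega -> R;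
  info_partition : forall i, finset.partition (info i) [set: Omega]%SET;
  endow_ge0 : forall i w, 0 <= endow i w;
  endow_meas : forall i, constant_on_cells (info i) (endow i);
  prior_gt0 : forall i w, 0 < prior i w;
  prior_sum1 : forall i, \sum_(w : Omega) prior i w = 1
}.

Section discrete.
Context {R : realType} {Y : banachLatticeType R} {Omega : finType} {n : nat}.
Variable E : economy Y Omega n.
Implicit Types (i : 'I_n.+1) (x y : 'I_n.+1 -> Omega -> Y).

Definition ex_ante i (z : Omega -> Y) : R :=
  \sum_(w : Omega) util E i w (z w) * prior E i w.

Definition plans i : set (Omega -> Y) :=
  [set z | (forall w, 0 <= z w) /\ constant_on_cells (info E i) z].

Definition feasible_allocation x : Prop :=
  (forall i, plans i (x i)) /\
  forall w, \sum_i x i w <= \sum_i endow E i w.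

Definition privately_pareto_optimal x : Prop :=
  feasible_allocation x /\
  ~ exists y, feasible_allocation y /\
      forall i, ex_ante i (y i) > ex_ante i (x i).

Definition pref i (z : Omega -> Y) : set (Omega -> Y) :=
  [set z' | plans i z' /\ ex_ante i z' > ex_ante i z].

(* {ptws Omega -> Y} carries the product topology on Y^Omega, which is the
   product norm topology as Omega is finite. *)
Definition ATY_proper i (z : Omega -> Y) : Prop :=
  exists Pt : set {ptws Omega -> Y},
    [/\ convex_set (Pt : set (convex_lmodType (Omega -> Y))),
        Pt° !=set0,
        Pt `&` plans i = pref i z &
        Pt° `&` plans i !=set0].

Definition price_system (pi : Omega -> {linear Y -> R^o}) : Prop :=
  (forall w, pos_dual Y (pi w)) /\ exists w (y : Y), pi w y != 0.

Definition value (pi : Omega -> {linear Y -> R^o}) (z : Omega -> Y) : R :=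
  \sum_(w : Omega) pi w (z w).

Definition budget (pi : Omega -> {linear Y -> R^o}) i : set (Omega -> Y) :=
  [set z | plans i z /\ value pi z <= value pi (endow E i)].

End discrete.

Section continuum.
Context {R : realType} {Y : banachLatticeType R} {Omega : finType} {n : nat}.
Variable E : economy Y Omega n.
Local Notation mu := (@lebesgue_measure R).
Implicit Types (f g : R -> Omega -> Y) (S : set (measurableTypeR R)).

Definition agent_space : set (measurableTypeR R) := `[0%R, 1%R]%classic.

(* With N = n.+1 agents and i counted from 0: [i/N, (i+1)/N[, closed at 1 for
   the last agent. *)
Definition type_block (i : 'I_n.+1) : set R :=
  if i == ord_max then `[i%:R / n.+1%:R, 1]%classic
  else `[i%:R / n.+1%:R, i.+1%:R / n.+1%:R[%classic.

(* The unique i with t \in type_block i when t is in [0, 1]; junk elsewhere. *)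
Definition agent_type (t : R) : 'I_n.+1 :=
  odflt ord0 [pick i | t \in type_block i].

Definition plans_c (t : R) : set (Omega -> Y) := plans E (agent_type t).
Definition endow_c (t : R) : Omega -> Y := endow E (agent_type t).
Definition ex_ante_c (t : R) : (Omega -> Y) -> R := ex_ante E (agent_type t).
Definition budget_c (pi : Omega -> {linear Y -> R^o}) (t : R) :
  set (Omega -> Y) := budget E pi (agent_type t).

Definition assignment_c f : Prop :=
  (forall t w, agent_space t -> 0 <= f t w) /\
  forall w, bochner_integrable mu agent_space (f ^~ w).

Definition allocation_c f : Prop :=
  assignment_c f /\ {ae mu, forall t, agent_space t -> plans_c t (f t)}.

Definition feasible_allocation_c f : Prop :=
  allocation_c f /\
  forall w, bochner_integral mu agent_space (f ^~ w)
         <= bochner_integral mu agent_space (endow_c ^~ w).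

Definition coalition S : Prop :=
  [/\ measurable S, S `<=` agent_space & (0 < mu S)%E].

Definition privately_blocks S f : Prop :=
  exists g, [/\ forall w, bochner_integrable mu S (g ^~ w),
    forall t, S t -> plans_c t (g t) /\ ex_ante_c t (g t) > ex_ante_c t (f t) &
    forall w, bochner_integral mu S (g ^~ w)
           <= bochner_integral mu S (endow_c ^~ w)].

Definition private_core f : Prop :=
  feasible_allocation_c f /\
  forall S, coalition S -> ~ privately_blocks S f.

Definition quasi_equilibrium f (pi : Omega -> {linear Y -> R^o}) : Prop :=
  [/\ feasible_allocation_c f,
      price_system pi,
      forall t, agent_space t -> budget_c pi t (f t) /\
        (value pi (endow_c t) != 0 ->
         forall z, budget_c pi t z -> ex_ante_c t z <= ex_ante_c t (f t)) &
      value pi (fun w => bochner_integral mu agent_space (f ^~ w)) =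
      value pi (fun w => bochner_integral mu agent_space (endow_c ^~ w))].

Definition nontrivial_prices (pi : Omega -> {linear Y -> R^o}) : Prop :=
  exists2 S, coalition S & forall t, S t -> value pi (endow_c t) != 0.

End continuum.

(* Main.v *)
Require Import Defs.
From HB Require Import structures.
From mathcomp Require Import all_boot all_order all_algebra finmap.
From mathcomp Require Import all_classical all_reals all_analysis.
From mathcomp Require Import measurable_realfun.
From mathcomp Require Import ring lra.
Import Order.TTheory GRing.Theory Num.Theory.
Import numFieldNormedType.Exports.
Local Open Scope classical_set_scope.
Local Open Scope ring_scope.

(** Write [a] for the total endowment, [K] for the common principal ideal of
    its values, which is dense, and [P i] for the plans that type [i] prefers
    to [x i].

    Since every type is a continuum of agents, the core property says more
    than Pareto optimality: weights [alpha i >= 0], not all zero, and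
    [y i \in P i] never satisfy [\sum_i alpha i *: (y i - endow i) <= 0], as
    the weights can be rescaled into the measures of the types in a blocking
    coalition ([core_no_improvement]).  So the convex cone of the trades [c]
    in [K^Omega] with [\sum_i alpha i *: (y i - endow i) <= c] for some
    weights and preferred plans cannot contain both [c] and [- c] with weights
    that do not all vanish, and prices are to be found by separation.  The
    positive cone may have an empty interior; what makes separation possible
    is properness.

    Properness provides a preferred plan [v i] in [K] with a norm ball around
    it, so that [(s (x i - k)^+ + v i) / (s + 1)] is preferred as soon as
    [s *: k] is small in norm ([properness_shave]).  The state-independent
    vector [k >= 0] is shaved off with the lattice operation [(x i - k)^+],
    which preserves both positivity and measurability with respect to any
    information.  In a Riesz space [\sum_i (x i - k)^+ <= a - k] when
    [0 <= x i], [\sum_i x i <= a] and [0 <= k <= a] ([pos_partB_sum]);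
    summing the net trades of these plans shows that the trade
    [\sum_i v i - a] can be perturbed within [K^Omega] by any vector of small
    norm and remain in the cone.  Here the size of [k] relative to [a] is
    controlled by the choice of [s], and this uses that [k] lies in [K], the
    ideal of every [a w].  Therefore the cone keeps a positive norm distance
    from the opposite of that trade ([improving_cone_far]).

    The distance to the cone is a sublinear functional on the whole of
    [Y^Omega], below the norm, and [hahn_banach] gives a linear functional
    below it that agrees with it at [\sum_i v i - a].  This functional is
    norm-continuous, positive, non-zero, and values every plan in [P i] at
    least as much as the endowment of [i] ([exists_supporting_price]).

    The equilibrium conditions follow in the usual way: [x i] is a limit of
    preferred plans, so by feasibility and positivity it is worth exactly the
    endowment; a preferred plan in the budget set could be scaled down; and
    prices at which all endowments are worth zero would vanish on [K].  The
    Bochner integrals involved are integrals of step functions, computed in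
    [bochner_integral_simple]. *)

Set Implicit Arguments.
Unset Strict Implicit.
Unset Printing Implicit Defensive.

(** * The Hahn-Banach theorem *)

Section hahn_banach.
Context {R : realType} {V : lmodType R}.
Implicit Types (p q : V -> R) (x y u : V).

Definition sublinear p : Prop :=
  (forall x y, p (x + y) <= p x + p y) /\
  (forall c x, 0 <= c -> p (c *: x) <= c * p x).

Lemma sublinear0 p : sublinear p -> p 0 = 0.
Proof.
move=> [pD pZ]; apply/eqP; rewrite eq_le; apply/andP; split.
  by have := pZ 0 0 (lexx _); rewrite scale0r mul0r.
by have := pD 0 0; rewrite addr0; lra.
Qed.

Lemma sublinear_opp p x : sublinear p -> - p (- x) <= p x.
Proof.
by move=> sp; have := sp.1 x (- x); rewrite subrr sublinear0 //; lra.
Qed.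

Lemma sublinear_scale p c x : sublinear p -> 0 <= c -> p (c *: x) = c * p x.
Proof.
move=> sp; rewrite le_eqVlt => /predU1P[<-|c0].
  by rewrite scale0r mul0r sublinear0.
apply/eqP; rewrite eq_le (sp.2 _ _ (ltW c0)) /= -ler_pdivlMl//.
have := sp.2 c^-1 (c *: x); rewrite scalerA mulVf ?gt_eqF// scale1r.
by apply; rewrite invr_ge0 ltW.
Qed.

(** The largest sublinear functional below [p] with value at most [- p u] at
    [- u]. *)
Definition flatten_along u p x : R :=
  inf [set p (x + t *: u) - t * p u | t in [set t | 0 <= t]].

Lemma flatten_along_has_inf u p x : sublinear p ->
  has_inf [set p (x + t *: u) - t * p u | t in [set t | 0 <= t]].
Proof.
move=> sp; split; first by exists (p (x + 0 *: u) - 0 * p u), 0 => /=.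
exists (- p (- x)) => _ [t /= t0 <-].
have := sp.1 (x + t *: u) (- x); rewrite addrAC subrr add0r.
by rewrite sublinear_scale//; lra.
Qed.

Lemma flatten_along_le u p x t : sublinear p -> 0 <= t ->
  flatten_along u p x <= p (x + t *: u) - t * p u.
Proof.
by move=> sp t0; apply: ge_inf; [exact: (flatten_along_has_inf u x sp).2|exists t].
Qed.

Lemma flatten_along_ge u p x m : sublinear p ->
  (forall t, 0 <= t -> m <= p (x + t *: u) - t * p u) ->
  m <= flatten_along u p x.
Proof.
move=> sp h; apply: lb_le_inf; first exact: (flatten_along_has_inf u x sp).1.
by move=> _ [t /= t0 <-]; exact: h.
Qed.

Lemma flatten_along_sublinear u p : sublinear p -> sublinear (flatten_along u p).
Proof.
move=> sp; split=> [x y|c x].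
  rewrite -lerBlDr; apply: flatten_along_ge => // s s0.
  rewrite lerBlDl -lerBlDr; apply: flatten_along_ge => // t t0.
  have := @flatten_along_le u p (x + y) (s + t) sp (addr_ge0 s0 t0).
  have := sp.1 (x + s *: u) (y + t *: u).
  by rewrite scalerDl addrACA; lra.
rewrite le_eqVlt => /predU1P[<-|c0].
  rewrite scale0r mul0r (le_trans (flatten_along_le _ _ sp (lexx 0)))//.
  by rewrite scale0r addr0 mul0r subr0 sublinear0.
rewrite -ler_pdivrMl//; apply: flatten_along_ge => // t t0.
rewrite ler_pdivrMl// (le_trans (flatten_along_le _ _ sp (mulr_ge0 (ltW c0) t0)))//.
have -> : c *: x + (c * t) *: u = c *: (x + t *: u).
  by rewrite scalerDr scalerA.
by rewrite (sublinear_scale _ sp (ltW c0)) mulrBr mulrA.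
Qed.

Lemma flatten_along_id u p x : sublinear p -> flatten_along u p x <= p x.
Proof.
move=> sp; rewrite (le_trans (flatten_along_le _ _ sp (lexx 0)))//.
by rewrite scale0r addr0 mul0r subr0.
Qed.

Lemma flatten_along_opp u p : sublinear p -> flatten_along u p (- u) <= - p u.
Proof.
move=> sp; rewrite (le_trans (flatten_along_le _ _ sp ler01))//.
by rewrite scale1r addNr mul1r sublinear0// sub0r.
Qed.

(** A sublinear functional that is minimal pointwise is odd, because
    flattening it along any direction changes nothing; being odd and
    subadditive it is linear.  Minimal ones exist by Zorn, the bound
    [- q (- x)] keeping the infimum of a chain finite. *)
Lemma exists_minimal_sublinear q : sublinear q -> exists p,
  [/\ sublinear p, forall x, p x <= q x & forall x, p (- x) <= - p x].
Proof.
move=> sq.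
pose T := {p : V -> R | sublinear p /\ forall x, p x <= q x}.
pose le (s t : T) := `[< forall x, sval t x <= sval s x >].
have leP s t : le s t -> forall x, sval t x <= sval s x by move/asboolP.
have lb (s : T) x : - q (- x) <= sval s x.
  case: s => p /= [sp pq]; rewrite (le_trans _ (sublinear_opp x sp))//.
  by rewrite lerN2.
have [||||[p [sp pq]] pmin] := @Zorn T le.
- by move=> t; apply/asboolP.
- move=> r s t /leP rs /leP st; apply/asboolP => x.
  exact: le_trans (st x) (rs x).
- move=> [s sP] [t tP] /leP /= st /leP /= ts; apply: eq_exist.
  by apply/funext => x; apply/eqP; rewrite eq_le st ts.
- move=> A Atot; have [[s0 As0]|/set0P/negP/negPn/eqP A0] := pselect (A !=set0);
    last by exists (exist _ q (conj sq (fun x => lexx _))) => s; rewrite A0.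
  pose F x := [set sval s x | s in A].
  have Finf x : has_inf (F x).
    split; first by exists (sval s0 x), s0.
    by exists (- q (- x)) => _ [s As <-]; exact: lb.
  have Fle x s : A s -> inf (F x) <= sval s x.
    by move=> As; apply: ge_inf; [exact: (Finf x).2|exists s].
  have Fge x m : (forall s, A s -> m <= sval s x) -> m <= inf (F x).
    move=> h; apply: lb_le_inf; first exact: (Finf x).1.
    by move=> _ [s As <-]; exact: h.
  have Fsub : sublinear (fun x => inf (F x)).
    split=> [x y|c x].
      rewrite -lerBlDr; apply: (Fge) => s As.
      rewrite lerBlDl -lerBlDr; apply: (Fge) => t At.
      (* the smaller of the two members of the chain serves both points *)
      wlog st : s t x y As At / forall x, sval s x <= sval t x.
        move=> h; have [/leP ts|/leP st] := Atot s t As At; last exact: h.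
        by have := h t s y x At As ts; rewrite (addrC y x); lra.
      have := Fle (x + y) _ As; have := (svalP s).1.1 x y.
      by have := st y; lra.
    rewrite le_eqVlt => /predU1P[<-|c0].
      rewrite scale0r mul0r (le_trans (Fle _ _ As0))//.
      by rewrite sublinear0//; exact: (svalP s0).1.
    rewrite -ler_pdivrMl//; apply: (Fge) => s As; rewrite ler_pdivrMl//.
    rewrite (le_trans (Fle _ _ As))//.
    exact: (svalP s).1.2 _ _ (ltW c0).
  have Fq x : inf (F x) <= q x.
    exact: le_trans (Fle _ _ As0) ((svalP s0).2 x).
  exists (exist _ (fun x => inf (F x)) (conj Fsub Fq)) => s As.
  by apply/asboolP => x /=; exact: Fle.
exists p; split=> // u.
pose p' := flatten_along u p.
have p'P : sublinear p' /\ forall x, p' x <= q x.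
  split=> [|x]; first exact: flatten_along_sublinear.
  exact: le_trans (flatten_along_id _ _ sp) (pq x).
have p'p : p' = p.
  apply: (congr1 sval (pmin (exist _ p' p'P) _)); apply/asboolP => x /=.
  exact: flatten_along_id.
by rewrite -[X in X (- u) <= _]p'p; exact: flatten_along_opp.
Qed.

(** Flattening [q] along [u] before passing to a minimal functional forces
    equality at [u], so that no extension from the line of [u] is needed. *)
Lemma hahn_banach q u : sublinear q -> exists l : {linear V -> R^o},
  (forall x, l x <= q x) /\ l u = q u.
Proof.
move=> sq.
have [p [sp pq pN]] :=
  exists_minimal_sublinear (flatten_along_sublinear u sq).
have pNE x : p (- x) = - p x.
  by apply/eqP; rewrite eq_le pN /=; have := sublinear_opp x sp; lra.
have pD x y : p (x + y) = p x + p y.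
  apply/eqP; rewrite eq_le sp.1 /=.
  by have := sp.1 (x + y) (- y); rewrite addrK pNE; lra.
have pZ c x : p (c *: x) = c * p x.
  have [c0|c0] := leP 0 c; first exact: sublinear_scale.
  apply: oppr_inj; rewrite -pNE -scaleNr -mulNr.
  by rewrite sublinear_scale// oppr_ge0 ltW.
have pl : linear (p : V -> R^o) by move=> c x y; rewrite pD pZ.
pose l : {linear V -> R^o} :=
  HB.pack (p : V -> R^o) (GRing.isLinear.Build R V R^o *:%R p pl).
exists l; split=> [x|].
  exact: le_trans (pq x) (flatten_along_id _ _ sq).
apply/eqP; rewrite eq_le (le_trans (pq u) (flatten_along_id _ _ sq)) /=.
rewrite -lerN2 -[leLHS]pNE (le_trans (pq (- u)))//.
exact: flatten_along_opp.
Qed.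

End hahn_banach.

(** * Banach lattices and principal ideals *)

Section riesz_space.
Context {R : realType} {Y : banachLatticeType R}.
Implicit Types (x y z b k : Y) (c : R).

Lemma bl_lerD2r z x y : x <= y -> x + z <= y + z.
Proof. exact: bl_leD2r. Qed.

Lemma bl_lerD x y z b : x <= y -> z <= b -> x + z <= y + b.
Proof.
move=> xy zb; apply: (@le_trans _ _ (y + z)); first exact: bl_lerD2r.
by rewrite ![y + _]addrC; exact: bl_lerD2r.
Qed.

Lemma bl_subr_ge0 x y : (0 <= y - x) = (x <= y).
Proof.
apply/idP/idP => h.
  by have := bl_lerD h (lexx x); rewrite add0r subrK.
by have := bl_lerD h (lexx (- x)); rewrite subrr.
Qed.

Lemma bl_lerBlDr x y z : (x - y <= z) = (x <= z + y).
Proof. by rewrite -[LHS]bl_subr_ge0 -[RHS]bl_subr_ge0 opprB addrA. Qed.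

Lemma bl_lerBrDr x y z : (x <= y - z) = (x + z <= y).
Proof.
by rewrite -[LHS]bl_subr_ge0 -[RHS]bl_subr_ge0 -addrA -opprD (addrC z).
Qed.

Lemma bl_lerN2 x y : (- x <= - y) = (y <= x).
Proof. by rewrite -[LHS]bl_subr_ge0 -[RHS]bl_subr_ge0 opprK addrC. Qed.

Lemma bl_ler_wpZ c x y : 0 <= c -> x <= y -> c *: x <= c *: y.
Proof. exact: bl_leZ. Qed.

Lemma bl_scaler_ge0 c x : 0 <= c -> 0 <= x -> 0 <= c *: x.
Proof. by move=> c0 /(bl_ler_wpZ c0); rewrite scaler0. Qed.

Lemma bl_addr_ge0 x y : 0 <= x -> 0 <= y -> 0 <= x + y.
Proof. by move=> x0 y0; have := bl_lerD x0 y0; rewrite addr0. Qed.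

Lemma bl_sumr_ge0 (I : Type) (r : seq I) (P : pred I) (F : I -> Y) :
  (forall i, P i -> 0 <= F i) -> 0 <= \sum_(i <- r | P i) F i.
Proof. by move=> F0; elim/big_ind: _ => //; exact: bl_addr_ge0. Qed.

Lemma bl_scaler_le c c' x : c <= c' -> 0 <= x -> c *: x <= c' *: x.
Proof.
move=> cc x0; rewrite -bl_subr_ge0 -scalerBl.
by apply: bl_scaler_ge0 => //; rewrite subr_ge0.
Qed.

Lemma labs_ge x : x <= labs x. Proof. exact: leUl. Qed.

Lemma labs_geN x : - x <= labs x. Proof. exact: leUr. Qed.

Lemma labs_le x y : x <= y -> - x <= y -> labs x <= y.
Proof. by move=> xy nxy; rewrite /labs leUx xy. Qed.

Lemma labs_ge0 x : 0 <= labs x.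
Proof.
have := bl_lerD (labs_ge x) (labs_geN x); rewrite subrr -mulr2n -scaler_nat.
have h : 0 <= 2^-1 :> R by rewrite invr_ge0.
by move/(bl_ler_wpZ h); rewrite scaler0 scalerA mulVf// scale1r.
Qed.

Lemma labs_id x : 0 <= x -> labs x = x.
Proof.
move=> x0; apply/le_anti; rewrite labs_ge andbT; apply: labs_le => //.
by apply: le_trans (x0); rewrite -oppr0 bl_lerN2.
Qed.

Lemma labsD x y : labs (x + y) <= labs x + labs y.
Proof.
apply: labs_le; first exact: bl_lerD (labs_ge x) (labs_ge y).
by rewrite opprD; exact: bl_lerD (labs_geN x) (labs_geN y).
Qed.

Lemma labsN x : labs (- x) = labs x.
Proof. by rewrite /labs opprK joinC. Qed.

Lemma labsZ_le c x : labs (c *: x) <= `|c| *: labs x.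
Proof.
wlog c0 : c / 0 <= c.
  move=> h; have [c0|c0] := leP 0 c; first exact: h.
  by rewrite -normrN -labsN -scaleNr; apply: h; rewrite oppr_ge0 ltW.
rewrite ger0_norm//; apply: labs_le; first exact: bl_ler_wpZ (labs_ge x).
by rewrite -scalerN; exact: bl_ler_wpZ (labs_geN x).
Qed.

Lemma labs_norm_le x y : labs x <= labs y -> `|x| <= `|y|.
Proof. exact: bl_norm_le. Qed.

Lemma norm_labs x : `|labs x| = `|x|.
Proof.
have e := labs_id (labs_ge0 x).
by apply/eqP; rewrite eq_le; apply/andP; split; apply: labs_norm_le; rewrite e.
Qed.

Lemma norm_le_pos x y : 0 <= x -> x <= y -> `|x| <= `|y|.
Proof.
by move=> x0 xy; apply: labs_norm_le; rewrite !labs_id// (le_trans x0).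
Qed.

Definition pos_part x : Y := Order.join x 0.

Lemma pos_part_ge0 x : 0 <= pos_part x. Proof. exact: leUr. Qed.

Lemma pos_part_ge x : x <= pos_part x. Proof. exact: leUl. Qed.

Lemma pos_part_le x y : 0 <= y -> x <= y -> pos_part x <= y.
Proof. by move=> y0 xy; rewrite /pos_part leUx xy. Qed.

Lemma pos_part_id x : 0 <= x -> pos_part x = x.
Proof. by move=> x0; apply/le_anti; rewrite pos_part_ge andbT pos_part_le. Qed.

Lemma pos_part_le_labs x : pos_part x <= labs x.
Proof. by apply: pos_part_le; [exact: labs_ge0|exact: labs_ge]. Qed.

Lemma labs_pos_part x : labs (pos_part x) <= labs x.
Proof. by rewrite labs_id ?pos_part_le_labs// pos_part_ge0. Qed.

(** The positive part is non-expansive, so approximants of a positive vector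
    may be taken positive. *)
Lemma pos_part_dist x y : `|pos_part x - pos_part y| <= `|x - y|.
Proof.
have half a b : pos_part a - pos_part b <= labs (a - b).
  rewrite bl_lerBlDr; apply: pos_part_le.
    by apply: bl_addr_ge0; [exact: labs_ge0|exact: pos_part_ge0].
  rewrite -[leLHS](subrK b); apply: bl_lerD (pos_part_ge b).
  exact: labs_ge.
apply: labs_norm_le; apply: labs_le; first exact: half.
by rewrite opprB -labsN opprB; exact: half.
Qed.

(** The left-hand side is the join of [x + y - k - k], [x - k], [y - k] and [0],
    each of which is below the right-hand side. *)
Lemma pos_partB_superadd k x y : 0 <= k -> 0 <= x -> 0 <= y ->
  pos_part (x - k) + pos_part (y - k) <= pos_part (x + y - k).
Proof.
move=> k0 x0 y0; rewrite -bl_lerBrDr; apply: pos_part_le.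
  rewrite bl_subr_ge0; apply: pos_part_le; first exact: pos_part_ge0.
  apply: le_trans (pos_part_ge _); apply: bl_lerD2r.
  by rewrite -[leLHS]add0r; exact: bl_lerD2r.
rewrite bl_lerBrDr addrC -bl_lerBrDr; apply: pos_part_le.
  rewrite bl_subr_ge0; apply: le_trans (pos_part_ge _); apply: bl_lerD2r.
  by rewrite -[leLHS]addr0; exact: bl_lerD.
rewrite bl_lerBrDr; apply: le_trans (pos_part_ge _).
have -> : y - k + (x - k) = x + y - k - k by rewrite addrACA addrA (addrC y).
by rewrite bl_lerBlDr -[leLHS]addr0; exact: bl_lerD.
Qed.

(** Free disposal seen from the shaved bundles: what is left after cutting [k]
    off every bundle fits in a total from which [k] is removed once. *)
Lemma pos_partB_sum (I : finType) k (X : I -> Y) b : 0 <= k ->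
  (forall i, 0 <= X i) -> \sum_i X i <= b -> k <= b ->
  \sum_i pos_part (X i - k) <= b - k.
Proof.
move=> k0 X0 Xb kb.
apply: (@le_trans _ _ (pos_part (\sum_i X i - k))); last first.
  by apply: pos_part_le; [rewrite bl_subr_ge0|exact: bl_lerD2r].
suff [] : 0 <= \sum_i X i /\
    \sum_i pos_part (X i - k) <= pos_part (\sum_i X i - k) by [].
pattern (\sum_i X i), (\sum_i pos_part (X i - k)).
apply: big_ind2.
- by split=> //; exact: pos_part_ge0.
- move=> a1 c1 a2 c2 [a10 c1a] [a20 c2a]; split; first exact: bl_addr_ge0.
  exact: le_trans (bl_lerD c1a c2a) (pos_partB_superadd k0 a10 a20).
- by move=> i _; split.
Qed.

End riesz_space.

Section principal_ideal.
Context {R : realType} {Y : banachLatticeType R} (e : Y) (e0 : 0 <= e).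
Local Notation K := (principal_ideal e).

Lemma idealP z : K z <-> exists2 c : R, 0 <= c & labs z <= c *: e.
Proof.
rewrite /principal_ideal /= (labs_id e0); split=> [[m zm]|[c c0 zc]].
  by exists m%:R.
exists (Num.truncn c).+1; apply: le_trans zc _; apply: bl_scaler_le => //.
exact/ltW/truncnS_gt.
Qed.

Lemma ideal_solid y z : K z -> labs y <= labs z -> K y.
Proof. by move=> [m zm] yz; exists m; exact: le_trans zm. Qed.

Lemma idealD y z : K y -> K z -> K (y + z).
Proof.
move=> /idealP[c c0 yc] /idealP[c' c'0 zc]; apply/idealP.
exists (c + c'); first exact: addr_ge0.
by rewrite scalerDl (le_trans (labsD _ _))// bl_lerD.
Qed.

Lemma idealZ c z : K z -> K (c *: z).
Proof.
move=> /idealP[c' c'0 zc]; apply/idealP; exists (`|c| * c').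
  exact: mulr_ge0.
by rewrite (le_trans (labsZ_le _ _))// -scalerA bl_ler_wpZ.
Qed.

Lemma ideal0 : K 0.
Proof. by exists 0%N; rewrite scale0r labs_id. Qed.

Lemma idealN z : K z -> K (- z).
Proof. by rewrite -scaleN1r; exact: idealZ. Qed.

Lemma idealB y z : K y -> K z -> K (y - z).
Proof. by move=> Ky /idealN; exact: idealD. Qed.

Lemma ideal_sum (I : Type) (r : seq I) (P : pred I) (F : I -> Y) :
  (forall i, P i -> K (F i)) -> K (\sum_(i <- r | P i) F i).
Proof.
by move=> KF; elim/big_ind: _ => //; [exact: ideal0|exact: idealD].
Qed.

Lemma ideal_le y z : 0 <= y -> y <= z -> K z -> K y.
Proof.
move=> y0 yz Kz; apply: ideal_solid Kz _.
by rewrite !labs_id// (le_trans y0).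
Qed.

Lemma ideal_labs z : K z -> K (labs z).
Proof. by move=> Kz; apply: ideal_solid Kz _; rewrite labs_id// labs_ge0. Qed.

Lemma ideal_pos_part z : K z -> K (pos_part z).
Proof. by move=> Kz; apply: ideal_solid Kz _; exact: labs_pos_part. Qed.

Lemma ideal_approx (y : Y) (eps : R) : dense K -> 0 <= y -> 0 < eps ->
  exists z, [/\ K z, 0 <= z & `|z - y| < eps].
Proof.
move=> dK y0 eps0.
have [|z [yz Kz]] := dK (ball y eps) _ (ball_open y eps).
  by exists y; exact: ballxx.
exists (pos_part z); split; [exact: ideal_pos_part|exact: pos_part_ge0|].
rewrite -(pos_part_id y0) (le_lt_trans (pos_part_dist z y))//.
by move: yz; rewrite -ball_normE /= distrC.
Qed.

End principal_ideal.

(** * The Bochner integral of simple functions *)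

Section bochner_simple.
Context {d : measure_display} {T : measurableType d} {R : realType}.
Context {Y : completeNormedModType R} {mu : {measure set T -> \bar R}}.
Context (D : set T) (mD : measurable D) (Doo : (mu D < +oo)%E).
Implicit Types (s h : T -> Y).

Local Notation piece tau x := (D `&` tau @^-1` [set x]).

(** Finite measurable partitions of [D] are presented as the fibres of a map
    with finitely many values; pairing two such maps refines both. *)
Definition finite_partition_map (X : choiceType) (r : seq X) (tau : T -> X) :=
  [/\ uniq r, forall t, D t -> tau t \in r & forall x, measurable (piece tau x)].

Lemma measure_sub_fin A : measurable A -> A `<=` D -> mu A \is a fin_num.
Proof.
move=> mA AD; rewrite ge0_fin_numE//; apply: le_lt_trans Doo.
by apply: le_measure; rewrite ?inE.
Qed.

Section partition_map.
Context {X : choiceType} {r : seq X} {tau : T -> X}.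
Context (taur : finite_partition_map r tau).

Lemma partition_map_bigcup (P : pred X) :
  D `&` tau @^-1` [set x | P x] =
  \bigcup_(x in [set` [seq x <- r | P x]]) (piece tau x).
Proof.
have [_ taur' _] := taur; apply/seteqP; split=> [t [/= Dt Pt]|t [x /=]].
  by exists (tau t) => //=; rewrite mem_filter Pt taur'.
by rewrite mem_filter => /andP[Px _] [Dt /= tx]; split=> //=; rewrite tx.
Qed.

Lemma measurable_partition_map (P : pred X) :
  measurable (D `&` tau @^-1` [set x | P x]).
Proof.
rewrite partition_map_bigcup; apply: fin_bigcup_measurable => //.
by move=> x _; have [] := taur.
Qed.

Lemma measure_partition_map (P : pred X) :
  fine (mu (D `&` tau @^-1` [set x | P x])) =
  \sum_(x <- r | P x) fine (mu (piece tau x)).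
Proof.
have [ur _ mtau] := taur; apply: EFin_inj.
rewrite fineK; last first.
  by apply: measure_sub_fin; [exact: measurable_partition_map|exact: subIsetl].
rewrite partition_map_bigcup measure_fin_bigcup//; last first.
  by apply/trivIsetP => x y _ _ /eqP xy; apply/seteqP; split=> // t
    [[_ /= tx] [_ /= ty]]; apply: xy; rewrite -tx.
rewrite -fsbig_seq ?filter_uniq// big_filter -sumEFin.
by apply: eq_bigr => x _; rewrite fineK// measure_sub_fin.
Qed.

Lemma level_partition_map s (phi : X -> Y) :
  (forall t, D t -> s t = phi (tau t)) ->
  forall y, D `&` s @^-1` [set y] = D `&` tau @^-1` [set x | phi x == y].
Proof.
move=> sphi y; apply/seteqP; split=> t [Dt /=]; rewrite sphi//.
  by move=> ->.
by move/eqP.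
Qed.

Lemma simple_partition_map s (phi : X -> Y) :
  (forall t, D t -> s t = phi (tau t)) -> simple_on mu D s.
Proof.
move=> sphi; have [_ taur' _] := taur.
have levelE := level_partition_map sphi.
have mlevel y : measurable (D `&` s @^-1` [set y]).
  by rewrite levelE; exact: measurable_partition_map.
split=> [||y _] //.
  apply: (@sub_finite_set _ _ [set` [seq phi x | x <- r]]) => //.
  move=> _ [t Dt <-] /=; rewrite sphi//; exact/map_f/taur'.
by rewrite -ge0_fin_numE//; apply: measure_sub_fin => //; exact: subIsetl.
Qed.

(** Level sets, through which the simple integral is defined, are unions of
    fibres of [tau]; regrouping the sum dispenses with them. *)
Lemma simple_integral_partition_map s (phi : X -> Y) :
  (forall t, D t -> s t = phi (tau t)) ->
  simple_integral mu D s =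
  \sum_(x <- r) fine (mu (piece tau x)) *: phi x.
Proof.
move=> sphi; have [sfin _ _] := simple_partition_map sphi.
have [ur taur' _] := taur.
have levelE := level_partition_map sphi.
rewrite /simple_integral fsbig_finite//=.
under eq_bigr => y _.
  rewrite levelE measure_partition_map scaler_suml big_mkcond /=.
  over.
rewrite exchange_big /=; apply: eq_bigr => x _.
have [xs|xs] := boolP (phi x \in fset_set (s @` D)).
  rewrite (bigD1_seq (phi x))//= ?fset_uniq// eqxx big1 ?addr0// => y.
  by rewrite eq_sym => /negbTE ->.
have -> : piece tau x = set0.
  apply/seteqP; split=> // t [Dt /= tx]; move/negP: xs; apply.
  by rewrite in_fset_set// inE; exists t => //; rewrite sphi// tx.
by rewrite measure0 scale0r big1// => y _; case: ifP => //; rewrite scale0r.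
Qed.

Lemma integral_partition_map (g : T -> R) (phi : X -> R) :
  (forall t, D t -> g t = phi (tau t)) -> (forall x, 0 <= phi x) ->
  (\int[mu]_(t in D) (g t)%:E)%E =
  (\sum_(x <- r) fine (mu (piece tau x)) * phi x)%:E.
Proof.
move=> gphi phi0; have [ur taur' mtau] := taur.
transitivity (\int[mu]_(t in D) \sum_(x <- r)
    (phi x * \1_(piece tau x) t)%:E)%E.
  apply: eq_integral => t /set_mem Dt; rewrite gphi//.
  rewrite (bigD1_seq (tau t)) ?taur'//= big1 ?adde0.
    by rewrite indicE mem_set//= mulr1.
  move=> x /eqP xt; rewrite indicE memNset ?mulr0//= => -[_ /= tx].
  by apply: xt; rewrite tx.
rewrite ge0_integral_sum//; last 2 first.
- move=> x; apply/measurable_EFinP; exact: measurable_funM.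
- by move=> x t _; rewrite lee_fin mulr_ge0.
rewrite -sumEFin; apply: eq_bigr => x _.
rewrite (integralZl_indic _ (fun _ => piece tau x))//; last first.
  by move=> h; move: (phi0 x); rewrite leNgt h.
rewrite integral_indic// setIAC setIid muleC EFinM fineK// measure_sub_fin//=.
Qed.

End partition_map.

Lemma simple_partition s h : simple_on mu D s -> simple_on mu D h ->
  exists r : seq (Y * Y), finite_partition_map r (fun t => (s t, h t)).
Proof.
move=> [sfin ms _] [hfin mh _].
exists [seq (y, c) | y <- fset_set (s @` D), c <- fset_set (h @` D)]; split.
- by apply: allpairs_uniq; rewrite ?fset_uniq// => -[? ?] [? ?].
- move=> t Dt; apply: allpairs_f; rewrite in_fset_set// inE; by exists t.
- move=> [y c].
  rewrite (_ : piece _ _ = piece s y `&` piece h c); first exact: measurableI.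
  apply/seteqP; split=> [t [Dt [<- <-]]//|t [[Dt sy] [_ hc]]].
  by split=> //=; rewrite sy hc.
Qed.

(** On a common refinement both integrals are sums over the same pieces, and
    the bound is the triangle inequality.  It makes the limit of the simple
    integrals independent of the approximating sequence. *)
Lemma le_norm_simple_integralB s h : simple_on mu D s -> simple_on mu D h ->
  (`|simple_integral mu D h - simple_integral mu D s|%:E <=
   \int[mu]_(t in D) `|h t - s t|%:E)%E.
Proof.
move=> ss sh; have [r rP] := simple_partition ss sh.
rewrite (simple_integral_partition_map rP (s := s) (phi := fst))//.
rewrite (simple_integral_partition_map rP (s := h) (phi := snd))//.
rewrite (integral_partition_map rP (phi := fun p => `|p.2 - p.1|))//.
rewrite lee_fin -sumrB (le_trans (ler_norm_sum _ _ _))//.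
apply: ler_sum => p _; rewrite -scalerBr normrZ ger0_norm // fine_ge0.
Qed.

Lemma bochner_approx_cst s : simple_on mu D s -> bochner_approx mu D s (fun=> s).
Proof.
move=> ss; split=> //.
rewrite (_ : (fun=> _) = cst 0%E); first exact: cvg_cst.
by apply/funext => k /=; rewrite integral0_eq// => t _; rewrite subrr normr0.
Qed.

Lemma bochner_integrable_simple s : simple_on mu D s -> bochner_integrable mu D s.
Proof.
move=> ss; split; last by exists (fun=> s); exact: bochner_approx_cst.
exists (fun=> s); split=> //; apply: aeW => t _; exact: cvg_cst.
Qed.

Lemma bochner_integral_simple s : simple_on mu D s ->
  bochner_integral mu D s = simple_integral mu D s.
Proof.
move=> ss; apply: get_unique.
  by exists (fun=> s); [exact: bochner_approx_cst|exact: cvg_cst].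
move=> v [u [su us] uv].
suff : simple_integral mu D (u k) @[k --> \oo] --> simple_integral mu D s.
  move=> us'; rewrite -(cvg_lim _ uv); last exact: norm_hausdorff.
  by rewrite (cvg_lim _ us')//; exact: norm_hausdorff.
have h : `|simple_integral mu D s - simple_integral mu D (u k)|
    @[k --> \oo] --> (0 : R^o).
  pose e k : \bar R :=
    `|simple_integral mu D s - simple_integral mu D (u k)|%:E.
  have : e @ \oo --> 0%:E.
    apply: squeeze_cvge us; last exact: cvg_cst.
    by near=> k; rewrite lee_fin normr_ge0 le_norm_simple_integralB.
  by move/fine_cvg.
rewrite -[X in _ --> X]subr0.
rewrite (_ : (fun k => _) = (fun k => simple_integral mu D s -
    (simple_integral mu D s - simple_integral mu D (u k)))); last first.
  by apply/funext => k; rewrite opprB addrC subrK.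
by apply: cvgB; [exact: cvg_cst|exact: norm_cvg0].
Unshelve. all: by end_near. Qed.

End bochner_simple.

(** * The continuum of agents and its coalitions *)

Section agents.
Context {R : realType} {Y : banachLatticeType R} {n : nat}.
Local Notation mu := (@lebesgue_measure R).
Local Notation N := (n.+1%:R : R).
Local Notation ty := (@agent_type R n).
Implicit Types (i j : 'I_n.+1) (t : R).

Lemma block_start_ge0 i : 0 <= i%:R / N.
Proof. by rewrite divr_ge0. Qed.

Lemma block_startS i : i.+1%:R / N = i%:R / N + N^-1.
Proof. by rewrite -natr1 mulrDl mul1r. Qed.

Lemma block_end_le1 i : i.+1%:R / N <= 1.
Proof. by rewrite ler_pdivrMr// mul1r ler_nat. Qed.

Lemma half_open_block_sub i (b : R) : b <= N^-1 ->
  `[i%:R / N, i%:R / N + b[ `<=` type_block i.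
Proof.
move=> bN t /=; rewrite in_itv /= => /andP[it tb].
have tN : t < i.+1%:R / N by rewrite block_startS (lt_le_trans tb)// lerD2l.
rewrite /type_block; case: ifP => _ /=; rewrite in_itv /= it //=.
exact: le_trans (ltW tN) (block_end_le1 i).
Qed.

Lemma block_sub_agent_space i : type_block i `<=` `[0 : R, 1].
Proof.
move=> t; rewrite /type_block; case: ifP => _ /=; rewrite !in_itv /=.
  by move=> /andP[it ->]; rewrite (le_trans (block_start_ge0 i)).
move=> /andP[it ti]; rewrite (le_trans (block_start_ge0 i))//=.
exact: le_trans (ltW ti) (block_end_le1 i).
Qed.

Lemma type_block_inj i j t : type_block i t -> type_block j t -> i = j.
Proof.
wlog ij : i j / (i < j)%N.
  move=> h it jt; case: (ltngtP i j) => [ij|ji|/val_inj//].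
    exact: h it jt.
  by rewrite (h _ _ ji jt it).
have im : (i == ord_max) = false.
  by apply/negP => /eqP im; move: ij; rewrite im ltnNge -ltnS ltn_ord.
rewrite {1}/type_block im /= in_itv /= => /andP[_ ti] jt.
have jt' : j%:R / N <= t.
  by move: jt; rewrite /type_block; case: ifP => _ /=; rewrite in_itv /= => /andP[].
move: ti; rewrite ltNge (le_trans _ jt')// ler_pM2r ?invr_gt0//.
by rewrite ler_nat.
Qed.

Lemma type_block_cover t : 0 <= t <= 1 -> exists i, type_block i t.
Proof.
move=> /andP[t0 t1].
have tN0 : 0 <= t * N by rewrite mulr_ge0.
have := truncn_itv tN0; set k := Num.truncn _ => /andP[kt tk].
have kt' : k%:R / N <= t by rewrite ler_pdivrMr.
have tk' : t < k.+1%:R / N by rewrite ltr_pdivlMr.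
have [kn|nk] := ltnP k n.+1; last first.
  exists ord_max; rewrite /type_block eqxx /= in_itv /= t1 andbT.
  apply: le_trans kt'; rewrite ler_pM2r ?invr_gt0// ler_nat.
  exact: ltnW.
exists (Ordinal kn); rewrite /type_block; case: ifP => _ /=.
  by rewrite in_itv /= kt' t1.
by rewrite in_itv /= kt' tk'.
Qed.

Lemma agent_typeE i t : type_block i t -> ty t = i.
Proof.
move=> it; rewrite /agent_type; case: pickP => [j /set_mem jt|/(_ i)] /=.
  exact: type_block_inj jt it.
by rewrite mem_set.
Qed.

Lemma type_block_agent_type t : 0 <= t <= 1 -> type_block (ty t) t.
Proof. by move=> /type_block_cover[i it]; rewrite (agent_typeE it). Qed.

Lemma agent_type_preimage i :
  `[0, 1] `&` ty @^-1` [set i] = type_block i.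
Proof.
apply/seteqP; split=> [t [/= t01 <-]|t it].
  by apply: type_block_agent_type; move: t01; rewrite in_itv.
by split; [exact: block_sub_agent_space it|exact: agent_typeE].
Qed.

Lemma measurable_type_block i : measurable (type_block i : set (measurableTypeR R)).
Proof. by rewrite /type_block; case: ifP => _; exact: measurable_itv. Qed.

Lemma measure_type_block i : mu (type_block i) = (N^-1)%:E.
Proof.
have ltN : i%:R / N < i.+1%:R / N by rewrite ltr_pM2r ?invr_gt0// ltr_nat.
rewrite /type_block; case: ifP => [/eqP im|_].
  have -> : `[i%:R / N, 1]%classic = `[i%:R / N, i.+1%:R / N]%classic.
    by rewrite im /= divff.
  rewrite lebesgue_measure_itv /= lte_fin ltN -EFinB; congr EFin.
  by rewrite block_startS addrAC subrr add0r.
rewrite lebesgue_measure_itv /= lte_fin ltN -EFinB; congr EFin.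
by rewrite block_startS addrAC subrr add0r.
Qed.

Lemma measure_half_open_block i (b : R) : 0 <= b ->
  mu `[i%:R / N, i%:R / N + b[%classic = b%:E.
Proof.
move=> b0; rewrite lebesgue_measure_itv /= lte_fin ltrDl; case: ltP => h.
  by rewrite -EFinB; congr EFin; rewrite addrAC subrr add0r.
by congr EFin; apply/eqP; rewrite eq_le b0 h.
Qed.

(** Initial segments of the blocks: the measure of the agents of type [i] is
    [b i] when [0 <= b i <= N^-1]. *)
Definition coalition_of (b : 'I_n.+1 -> R) : set (measurableTypeR R) :=
  \bigcup_(i in [set: 'I_n.+1]) `[i%:R / N, i%:R / N + b i[%classic.

Lemma coalition_of_sub b : (forall i, b i <= N^-1) ->
  coalition_of b `<=` agent_space.
Proof.
by move=> bN t [i _ /(half_open_block_sub (bN i)) /block_sub_agent_space].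
Qed.

Lemma measurable_coalition_of b : measurable (coalition_of b).
Proof. by apply: fin_bigcup_measurable => // i _; exact: measurable_itv. Qed.

Lemma coalition_of_piece b i : (forall j, b j <= N^-1) ->
  coalition_of b `&` ty @^-1` [set i] =
  `[i%:R / N, i%:R / N + b i[%classic.
Proof.
move=> bN; apply/seteqP; split=> [t [[j _ jt] /= ti]|t it].
  by rewrite -ti (agent_typeE (half_open_block_sub (bN j) jt)).
by split; [exists i|exact: agent_typeE (half_open_block_sub (bN i) it)].
Qed.

Lemma bochner_types (D : set (measurableTypeR R)) (c : 'I_n.+1 -> Y)
    (h : R -> Y) :
  measurable D -> D `<=` agent_space ->
  (forall i, measurable (D `&` ty @^-1` [set i])) ->
  (forall t, D t -> h t = c (ty t)) ->
  bochner_integrable mu D h /\ bochner_integral mu D h =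
  \sum_i fine (mu (D `&` ty @^-1` [set i])) *: c i.
Proof.
move=> mD DI mp hc.
have Doo : (mu D < +oo)%E.
  apply: (@le_lt_trans _ _ (mu agent_space)).
    by apply: le_measure; rewrite ?inE//; exact: measurable_itv.
  by rewrite lebesgue_measure_itv /= lte01 oppr0 adde0 ltry.
have P : finite_partition_map D (index_enum 'I_n.+1) ty.
  by split=> [|t _|i] //; [exact: index_enum_uniq|exact: mem_index_enum].
have sh := simple_partition_map mD Doo P hc.
split; first exact: bochner_integrable_simple.
rewrite bochner_integral_simple//.
exact: simple_integral_partition_map.
Qed.

Lemma bochner_agent_space (c : 'I_n.+1 -> Y) (h : R -> Y) :
  (forall i t, type_block i t -> h t = c i) ->
  bochner_integral mu agent_space h = N^-1 *: \sum_i c i.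
Proof.
move=> hc; have [||i|t t01|_ ->] := @bochner_types agent_space c h.
- exact: measurable_itv.
- by [].
- by rewrite agent_type_preimage; exact: measurable_type_block.
- by apply: hc; apply: type_block_agent_type; move: t01; rewrite /agent_space /= in_itv.
rewrite scaler_sumr; apply: eq_bigr => i _.
by rewrite agent_type_preimage measure_type_block.
Qed.

Lemma bochner_coalition_of b (c : 'I_n.+1 -> Y) (h : R -> Y) :
  (forall i, 0 <= b i <= N^-1) ->
  (forall t, coalition_of b t -> h t = c (ty t)) ->
  bochner_integrable mu (coalition_of b) h /\
  bochner_integral mu (coalition_of b) h = \sum_i b i *: c i.
Proof.
move=> bN hc.
have bN' i : b i <= N^-1 by have /andP[] := bN i.
have [|||//|int ->] := @bochner_types (coalition_of b) c h.
- exact: measurable_coalition_of.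
- exact: coalition_of_sub.
- by move=> i; rewrite coalition_of_piece//; exact: measurable_itv.
split=> //; apply: eq_bigr => i _; rewrite coalition_of_piece//.
by rewrite measure_half_open_block//; have /andP[] := bN i.
Qed.

End agents.

Section core.
Context {R : realType} {Y : banachLatticeType R} {Omega : finType} {n : nat}.
Context {E : economy Y Omega n}.
Context {f : R -> Omega -> Y} {x : 'I_n.+1 -> Omega -> Y}.
Context (f_step : forall i t, type_block i t -> f t = x i).
Local Notation mu := (@lebesgue_measure R).
Local Notation N := (n.+1%:R : R).
Local Notation ty := (@agent_type R n).
Implicit Types (i : 'I_n.+1).

Lemma endow_c_step i t : type_block i t -> endow_c E t = endow E i.
Proof. by move=> it; rewrite /endow_c (agent_typeE it). Qed.

Lemma integral_step w :
  bochner_integral mu agent_space (f ^~ w) = N^-1 *: \sum_i x i w.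
Proof. by apply: bochner_agent_space => i t it; rewrite (f_step it). Qed.

Lemma integral_endow w :
  bochner_integral mu agent_space (endow_c E ^~ w) = N^-1 *: \sum_i endow E i w.
Proof. by apply: bochner_agent_space => i t it; rewrite (endow_c_step it). Qed.

Lemma feasible_step : feasible_allocation_c E f -> feasible_allocation E x.
Proof.
move=> [[_ [Z [mZ Z0 fZ]]] fle]; split=> [i|w].
  (* a block has positive measure, so it meets any set of full measure *)
  have [t [it Zt]] : exists t, type_block i t /\ ~ Z t.
    apply: contrapT => h.
    have : (mu (type_block i) <= mu Z)%E.
      apply: le_measure; rewrite ?inE//; first exact: measurable_type_block.
      by move=> t it; apply: contrapT => Zt; apply: h; exists t.
    by rewrite measure_type_block Z0 lee_fin leNgt invr_gt0 ltr0Sn.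
  have := contra_not (fZ t) Zt; rewrite /= not_notE => /(_ _).
  rewrite /plans_c (agent_typeE it) (f_step it); apply.
  exact: block_sub_agent_space it.
have := fle w; rewrite integral_step integral_endow.
have N0 : 0 <= N by [].
by move/(bl_ler_wpZ N0); rewrite !scalerA divff// !scale1r.
Qed.

(** Weights that make an improvement self-financing would, once scaled below
    the size of a block, be the measures of the types in a blocking
    coalition. *)
Lemma core_no_improvement (alpha : 'I_n.+1 -> R) (y : 'I_n.+1 -> Omega -> Y) :
  private_core E f -> (forall i, 0 <= alpha i) ->
  (forall i, pref E i (x i) (y i)) ->
  (forall w, \sum_i alpha i *: (y i w - endow E i w) <= 0) ->
  forall i, alpha i = 0.
Proof.
move=> [_ fcore] alpha0 prefy yle i0; apply: contrapT => /eqP ai0.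
pose M := \sum_i alpha i.
have aM i : alpha i <= M.
  by rewrite /M (bigD1 i)//= lerDl sumr_ge0.
have ai0' : 0 < alpha i0 by rewrite lt_neqAle eq_sym ai0 alpha0.
have M0 : 0 < M := lt_le_trans ai0' (aM i0).
pose b i := N^-1 * M^-1 * alpha i.
have k0 : 0 < N^-1 * M^-1 by rewrite mulr_gt0 ?invr_gt0.
have bN i : 0 <= b i <= N^-1.
  rewrite mulr_ge0 ?(ltW k0)//= /b -mulrA ler_piMr ?invr_ge0//.
  by rewrite ler_pdivrMl// mulr1.
have bN' i : b i <= N^-1 by have /andP[] := bN i.
pose S := @coalition_of R n b.
have SI : S `<=` agent_space := coalition_of_sub bN'.
have cS : coalition S.
  split=> //; first exact: measurable_coalition_of.
  apply: (@lt_le_trans _ _ (b i0)%:E); first by rewrite lte_fin mulr_gt0.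
  have /andP[b0 _] := bN i0; rewrite -(measure_half_open_block i0 b0).
  apply: le_measure; rewrite ?inE; first exact: measurable_itv.
    exact: measurable_coalition_of.
  by move=> t it; exists i0.
apply: (fcore S cS); exists (fun t => y (ty t)).
have St t : S t -> type_block (ty t) t.
  by move=> /SI; rewrite /agent_space /= in_itv => /type_block_agent_type.
split=> [w|t /St it|w].
- by have [] := @bochner_coalition_of R Y n b (fun i => y i w)
    (fun t => y (ty t) w) bN (fun t _ => erefl).
- by rewrite /plans_c /ex_ante_c (f_step it); exact: prefy.
have [_ ->] := @bochner_coalition_of R Y n b (fun i => y i w)
  (fun t => y (ty t) w) bN (fun t _ => erefl).
have [_ ->] := @bochner_coalition_of R Y n b (fun i => endow E i w)
  (fun t => endow_c E t w) bN (fun t _ => erefl).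
rewrite -[leRHS]add0r -bl_lerBlDr -sumrB.
have := bl_ler_wpZ (ltW k0) (yle w); rewrite scaler0; congr (_ <= _).
by rewrite scaler_sumr; apply: eq_bigr => i _; rewrite -scalerBr scalerA.
Qed.

Lemma core_pareto_optimal : private_core E f -> privately_pareto_optimal E x.
Proof.
move=> fcore; split; first by apply: feasible_step; case: fcore.
move=> [y [[yplans yle] yx]].
have h w : \sum_i 1 *: (y i w - endow E i w) <= 0.
  under eq_bigr do rewrite scale1r.
  by rewrite sumrB bl_lerBlDr add0r.
have /eqP := core_no_improvement fcore (fun=> ler01)
  (fun i => conj (yplans i) (yx i)) h ord0.
by rewrite oner_eq0.
Qed.

End core.

(** * Preferences and properness *)

(** Boxes around [v] generate a filter that converges coordinatewise, hence in
    the product topology. *)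
Lemma nbhs_box {R : realType} {V : normedModType R} {I : finType}
    (v : {ptws I -> V}) (A : set {ptws I -> V}) :
  nbhs v A -> exists2 r : R, 0 < r &
    forall u, (forall w, `|u w - v w| < r) -> A u.
Proof.
pose F := filter_from [set r : R | 0 < r]
  (fun r => [set u : {ptws I -> V} | forall w, `|u w - v w| < r]).
have FF : Filter F.
  apply: filter_from_filter; first by exists 1; exact: ltr01.
  move=> r s /= r0 s0; exists (Num.min r s); first by rewrite /= lt_min r0.
  by move=> u /= h; split=> w; have := h w; rewrite lt_min => /andP[].
suff cv : F --> v by move=> /cv [r r0 rA]; exists r => // u /rA.
apply/cvg_sup => w; rewrite cvg_image; last first.
  by apply/seteqP; split=> // z _; exists (fun=> z).
move=> B /nbhs_ballP[r /= r0 rB].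
exists [set u : {ptws I -> V} | B (u w)].
  exists r => // u /= uv; apply: rB; rewrite -ball_normE /= distrC.
  exact: uv.
by apply/seteqP; split=> [z [u Bu <-]//|z Bz]; exists (fun=> z).
Qed.

Section preferences.
Context {R : realType} {Y : banachLatticeType R} {Omega : finType} {n : nat}.
Context (E : economy Y Omega n).
Implicit Types (i : 'I_n.+1) (z y : Omega -> Y).

Lemma plans_map2 i (F : Y -> Y -> Y) z y :
  (forall u v, 0 <= u -> 0 <= v -> 0 <= F u v) ->
  plans E i z -> plans E i y -> plans E i (fun w => F (z w) (y w)).
Proof.
move=> F0 [z0 zc] [y0 yc]; split=> [w|A iA w w' wA w'A]; first exact: F0.
by rewrite (zc _ iA _ _ wA w'A) (yc _ iA _ _ wA w'A).
Qed.

Lemma plans_conv i z y (l : R) : 0 <= l <= 1 -> plans E i z -> plans E i y ->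
  plans E i (fun w => l *: z w + (1 - l) *: y w).
Proof.
move=> /andP[l0 l1].
apply: (@plans_map2 i (fun u v => l *: u + (1 - l) *: v)) => u v u0 v0.
by apply: bl_addr_ge0; apply: bl_scaler_ge0; rewrite ?subr_ge0.
Qed.

(** The approximation is made value by value, so it depends on the state only
    through the value of the plan and respects the private information. *)
Lemma plans_approx i (e : Y) y (d : R) : dense (principal_ideal e) ->
  plans E i y -> 0 < d -> exists y',
  [/\ plans E i y', forall w, principal_ideal e (y' w) &
      forall w, `|y' w - y w| < d].
Proof.
move=> dK [y0 yc] d0.
have /choice[phi phiP] : forall u : Y, exists u' : Y, 0 <= u ->
    [/\ principal_ideal e u', 0 <= u' & `|u' - u| < d].
  move=> u; have [u0|/negP u0] := boolP (0 <= u); last by exists 0.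
  by have [u' u'P] := ideal_approx dK u0 d0; exists u'.
exists (phi \o y); split=> [|w|w] /=; try by have [] := phiP _ (y0 w).
split=> [w|A iA w w' wA w'A] /=; first by have [] := phiP _ (y0 w).
by rewrite (yc _ iA _ _ wA w'A).
Qed.

Context (continuity : forall i w, {within pos_cone Y, continuous (util E i w)}).
Context (concavity : forall i w, concave_on (pos_cone Y) (util E i w)).

Lemma ex_ante_concave i z y (l : R) : 0 <= l <= 1 ->
  plans E i z -> plans E i y ->
  l * ex_ante E i z + (1 - l) * ex_ante E i y <=
  ex_ante E i (fun w => l *: z w + (1 - l) *: y w).
Proof.
move=> l01 [z0 _] [y0 _]; rewrite !mulr_sumr -big_split; apply: ler_sum => w _.
rewrite /= !mulrA -mulrDl ler_pM2r ?prior_gt0//.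
exact: concavity (z0 w) (y0 w) l01.
Qed.

Lemma pref_conv i x z y (l : R) : 0 <= l <= 1 ->
  pref E i x z -> pref E i x y ->
  pref E i x (fun w => l *: z w + (1 - l) *: y w).
Proof.
move=> l01 [zi xz] [yi xy]; split; first exact: plans_conv.
apply: lt_le_trans (ex_ante_concave l01 zi yi).
have /andP[l0 l1] := l01.
set vx := ex_ante E i x; have -> : vx = l * vx + (1 - l) * vx by ring.
move: l0; rewrite le_eqVlt => /predU1P[<-|l0].
  by rewrite !mul0r !add0r subr0 !mul1r.
apply: ltr_leD; first by rewrite ltr_pM2l.
by rewrite ler_wpM2l ?subr_ge0// ltW.
Qed.

Lemma pref_segment i x y (l : R) : 0 <= l -> l < 1 ->
  plans E i x -> pref E i x y ->
  pref E i x (fun w => l *: x w + (1 - l) *: y w).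
Proof.
move=> l0 l1 xi [yi xy]; have l01 : 0 <= l <= 1 by rewrite l0 ltW.
split; first exact: plans_conv.
apply: lt_le_trans (ex_ante_concave l01 xi yi).
rewrite -subr_gt0 [ltRHS](_ : _ = (1 - l) * (ex_ante E i y - ex_ante E i x)).
  by rewrite mulr_gt0 ?subr_gt0.
by ring.
Qed.

Lemma pref_open i x y : pref E i x y -> exists2 d : R, 0 < d & forall y',
  plans E i y' -> (forall w, `|y' w - y w| < d) -> pref E i x y'.
Proof.
move=> [[y0 yc] xy].
pose gap := ex_ante E i y - ex_ante E i x.
have gap0 : 0 < gap by rewrite subr_gt0.
have /choice[dl dlP] : forall w, exists dw : R, 0 < dw /\ forall u, 0 <= u ->
    `|u - y w| < dw -> util E i w (y w) - util E i w u < gap / 2.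
  move=> w; have /subspace_continuousP/(_ (y w) (y0 w)) := @continuity i w.
  have gap20 : 0 < gap / 2 by rewrite divr_gt0.
  move=> /cvgrPdist_lt /(_ _ gap20) /nbhs_ballP[dw /= dw0 h].
  exists dw; split=> // u u0 ud; apply: le_lt_trans (ler_norm _) (h u _ _) => //.
  by rewrite -ball_normE /= distrC.
pose d := \big[Num.min/1]_w dl w.
exists d; first by apply: lt_bigmin => // w _; case: (dlP w).
move=> y' y'i y'd; split=> //.
have h : ex_ante E i y - ex_ante E i y' <= gap / 2.
  rewrite -sumrB [leRHS](_ : _ = \sum_w (gap / 2) * prior E i w); last first.
    by rewrite -mulr_sumr prior_sum1 mulr1.
  apply: ler_sum => w _; rewrite -mulrBl ler_pM2r ?prior_gt0// ltW//.
  have [_] := dlP w; apply; first by have [] := y'i.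
  by apply: lt_le_trans (y'd w) _; exact: bigmin_le.
by rewrite /gap in h gap0; lra.
Qed.

(** What properness gives: one may shave a small positive vector [k] off a
    plan [z] and still reach a preferred plan by mixing in a little of a fixed
    plan [v], taken in the dense ideal.  Only the norm of [s *: k] matters, so
    [k] may be made as small as needed relative to any order unit of the
    ideal by taking [s] large. *)
Lemma properness_shave i z (e : Y) : dense (principal_ideal e) ->
  plans E i z -> ATY_proper E i z -> exists v (r : R),
  [/\ 0 < r, pref E i z v, forall w, principal_ideal e (v w) &
   forall (s : R) (k : Y), 0 <= s -> 0 <= k -> 2 * s * `|k| < r ->
     pref E i z
      (fun w => (s + 1)^-1 *: (s *: pos_part (z w - k) + v w))].
Proof.
move=> dK zi [Pt [cPt _ PtE [v0 [v0Pt v0i]]]].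
have [r0 r00 r0P] := nbhs_box v0Pt.
have r20 : 0 < r0 / 2 by rewrite divr_gt0.
have [v [vi Kv vd]] := plans_approx dK v0i r20.
have vPt u : (forall w, `|u w - v w| < r0 / 2) -> Pt u.
  move=> uv; apply: r0P => w.
  rewrite -(subrK (v w) (u w)) -addrA (le_lt_trans (ler_normD _ _))//.
  by rewrite [ltRHS]splitr ltrD.
have PtP u : plans E i u -> Pt u -> pref E i z u by rewrite -PtE; split.
have PPt u : pref E i z u -> Pt u by rewrite -PtE => -[].
have pv : pref E i z v.
  by apply: PtP => //; apply: vPt => w; rewrite subrr normr0.
have conv (l : R) u u' : 0 <= l <= 1 -> Pt u -> Pt u' ->
    Pt (fun w => l *: u w + (1 - l) *: u' w).
  move=> /andP[l0 l1] Pu Pu'.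
  pose l' : {i01 R} := Itv01 l0 l1.
  by have /(_ _ _ l' (mem_set Pu) (mem_set Pu'))/set_mem := cPt.
exists v, (r0 / 2); split=> // s k s0 k0 sk.
have s10 : 0 < s + 1 by rewrite ltr_wpDl.
apply: PtP.
  apply: (@plans_map2 i (fun u u' => (s + 1)^-1 *: (s *: pos_part (u - k) + u'))
    z v) => // u u' u0 u'0.
  apply: bl_scaler_ge0; first by rewrite invr_ge0 ltW.
  by apply: bl_addr_ge0 => //; apply: bl_scaler_ge0 => //; exact: pos_part_ge0.
(* [v] is split in two halves: one is mixed with [z], which gives a preferred
   plan by concavity; the other absorbs the shaving, which keeps it in the
   ball around [v]; the final plan is a convex combination of the two *)
pose l : R := (2 * s + 1) / (2 * s + 2).
have l01 : 0 <= l <= 1.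
  have s2 : 0 < 2 * s + 2 by lra.
  by rewrite divr_ge0/= ?ler_pdivrMr//; lra.
pose m : R := 2 * s / (2 * s + 1).
have s3 : 0 < 2 * s + 1 by lra.
have m0 : 0 <= m by rewrite divr_ge0 ?mulr_ge0// ltW.
have m1 : m < 1 by rewrite ltr_pdivrMr//; lra.
have P1 := PPt _ (pref_segment m0 m1 zi pv).
pose u w := v w - (2 * s) *: (z w - pos_part (z w - k)).
have P2 : Pt u.
  apply: vPt => w; rewrite /u addrAC subrr add0r normrN normrZ.
  rewrite ger0_norm ?mulr_ge0//.
  apply: le_lt_trans sk; rewrite ler_wpM2l ?mulr_ge0//.
  have [z0 _] := zi.
  apply: norm_le_pos.
    rewrite bl_subr_ge0; apply: pos_part_le => //.
    by rewrite bl_lerBlDr -[leLHS]addr0; exact: bl_lerD.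
  by rewrite bl_lerBlDr addrC -bl_lerBlDr; exact: pos_part_ge.
have := conv l _ _ l01 P1 P2; congr Pt; apply/funext => w.
have e1 : l * m = s / (s + 1).
  by rewrite /l /m; field; rewrite !gt_eqF//; lra.
have e2 : l * (1 - m) + (1 - l) = (s + 1)^-1.
  by rewrite /l /m; field; rewrite !gt_eqF//; lra.
have e3 : (1 - l) * (2 * s) = s / (s + 1).
  by rewrite /l; field; rewrite !gt_eqF//; lra.
rewrite /u; set p := pos_part _.
rewrite scalerDr !scalerA e1 scalerBr scalerA e3 scalerBr opprB.
rewrite -addrA addrC !addrA addrNK -scalerDl e2 scalerDr scalerA.
by rewrite (mulrC _ s) addrC.
Qed.

End preferences.

(** * Supporting prices *)

Section supporting_price.
Context {R : realType} {Y : banachLatticeType R} {Omega : finType} {n : nat}.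
Context {E : economy Y Omega n}.
Context (continuity : forall i w, {within pos_cone Y, continuous (util E i w)}).
Context (concavity : forall i w, concave_on (pos_cone Y) (util E i w)).
Context {e : Y} (e0 : 0 <= e) (dK : dense (principal_ideal e)).
Context (aK : forall w,
  principal_ideal (\sum_i endow E i w) = principal_ideal e).
Context {x : 'I_n.+1 -> Omega -> Y} (xfeas : feasible_allocation E x).
Context (no_improvement : forall (alpha : 'I_n.+1 -> R) y,
  (forall i, 0 <= alpha i) -> (forall i, pref E i (x i) (y i)) ->
  (forall w, \sum_i alpha i *: (y i w - endow E i w) <= 0) ->
  forall i, alpha i = 0).
Context (proper : forall i, ATY_proper E i (x i)).
Local Notation K := (principal_ideal e).
Local Notation a w := (\sum_i endow E i w).
Implicit Types (i : 'I_n.+1) (w : Omega) (c z : Omega -> Y).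

Lemma total_endow_ge0 w : 0 <= a w.
Proof. by apply: bl_sumr_ge0 => i _; exact: endow_ge0. Qed.

Lemma ideal_total_endow w : K (a w).
Proof. by rewrite -(aK w); exists 1%N; rewrite scale1r. Qed.

Lemma ideal_endow i w : K (endow E i w).
Proof.
apply: (@ideal_le _ _ _ _ (a w)) (ideal_total_endow w); first exact: endow_ge0.
rewrite (bigD1 i)//= -[leLHS]addr0; apply: bl_lerD => //.
by apply: bl_sumr_ge0 => j _; exact: endow_ge0.
Qed.

Definition norm1 z : R := \sum_w `|z w|.

Lemma norm1_ge0 z : 0 <= norm1 z. Proof. exact: sumr_ge0. Qed.

Lemma norm1D z c : norm1 (fun w => z w + c w) <= norm1 z + norm1 c.
Proof. by rewrite -big_split; apply: ler_sum => w _; exact: ler_normD. Qed.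

Lemma norm1Z (l : R) z : norm1 (fun w => l *: z w) = `|l| * norm1 z.
Proof. by rewrite mulr_sumr; apply: eq_bigr => w _; rewrite normrZ. Qed.

(** The net trades in the ideal that are enough, under some weights on the
    types, to move every type of positive weight to a preferred plan.  All
    weights may vanish, so that the cone contains the positive cone of the
    ideal; this is what makes the prices positive. *)
Definition improving_cone : set (Omega -> Y) := [set c | (forall w, K (c w)) /\
  exists (alpha : 'I_n.+1 -> R) y,
  [/\ forall i, 0 <= alpha i, forall i, pref E i (x i) (y i) &
      forall w, \sum_i alpha i *: (y i w - endow E i w) <= c w]].

(** The cone is convex because preferences are. *)
Lemma weights_comb (alpha beta : 'I_n.+1 -> R) (y z : 'I_n.+1 -> Omega -> Y) :
  (forall i, 0 <= alpha i) -> (forall i, pref E i (x i) (y i)) ->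
  (forall i, 0 <= beta i) -> (forall i, pref E i (x i) (z i)) ->
  exists2 u, forall i, pref E i (x i) (u i) & forall w,
    \sum_i (alpha i + beta i) *: (u i w - endow E i w) =
    \sum_i alpha i *: (y i w - endow E i w) +
    \sum_i beta i *: (z i w - endow E i w).
Proof.
move=> a0 py b0 pz.
have /choice[u uP] : forall i, exists u, pref E i (x i) u /\ forall w,
    (alpha i + beta i) *: (u w - endow E i w) =
    alpha i *: (y i w - endow E i w) + beta i *: (z i w - endow E i w).
  move=> i; have [ab0|ab0] := eqVneq (alpha i + beta i) 0.
    have ai : alpha i = 0 by have := a0 i; have := b0 i; lra.
    have bi : beta i = 0 by have := a0 i; have := b0 i; lra.
    exists (y i); split=> // w; rewrite ai bi.
    by rewrite addr0 !scale0r addr0.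
  have ab0' : 0 < alpha i + beta i by rewrite lt_neqAle eq_sym ab0 addr_ge0.
  pose l := alpha i / (alpha i + beta i).
  have l01 : 0 <= l <= 1.
    by rewrite divr_ge0 ?(ltW ab0')//= ler_pdivrMr// mul1r lerDl.
  exists (fun w => l *: y i w + (1 - l) *: z i w); split=> [|w].
    exact: pref_conv.
  have e1 : (alpha i + beta i) * l = alpha i by rewrite mulrC divfK.
  have e2 : (alpha i + beta i) * (1 - l) = beta i.
    by rewrite mulrBr mulr1 e1 addrC addKr.
  rewrite scalerBr scalerDr !scalerA e1 e2 !scalerBr scalerDl opprD.
  by rewrite addrACA.
exists u => [i|w]; first by case: (uP i).
by rewrite -big_split; apply: eq_bigr => i _; case: (uP i).
Qed.

Lemma improving_coneD c c' : improving_cone c -> improving_cone c' ->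
  improving_cone (fun w => c w + c' w).
Proof.
move=> [Kc [al [y [al0 yP yc]]]] [Kc' [be [z [be0 zP zc']]]]; split.
  by move=> w; exact: idealD.
have [u uP uE] := weights_comb al0 yP be0 zP.
exists (fun i => al i + be i), u; split=> // [i|w]; first exact: addr_ge0.
by rewrite uE; exact: bl_lerD.
Qed.

Lemma improving_coneZ (l : R) c : 0 <= l -> improving_cone c ->
  improving_cone (fun w => l *: c w).
Proof.
move=> l0 [Kc [al [y [al0 yP yc]]]]; split; first by move=> w; exact: idealZ.
exists (fun i => l * al i), y; split=> // [i|w]; first exact: mulr_ge0.
have := bl_ler_wpZ l0 (yc w); rewrite scaler_sumr; congr (_ <= _).
by apply: eq_bigr => i _; rewrite scalerA.
Qed.

Lemma uniform_shave : exists v (r : R),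
  [/\ 0 < r, forall i, pref E i (x i) (v i), forall i w, K (v i w) &
   forall i (s : R) (k : Y), 0 <= s -> 0 <= k -> s * `|k| < r ->
     pref E i (x i)
       (fun w => (s + 1)^-1 *: (s *: pos_part (x i w - k) + v i w))].
Proof.
have /choice[v /choice[r vrP]] : forall i, exists v, exists r : R,
  [/\ 0 < r, pref E i (x i) v, forall w, K (v w) &
   forall (s : R) (k : Y), 0 <= s -> 0 <= k -> 2 * s * `|k| < r ->
     pref E i (x i) (fun w => (s + 1)^-1 *: (s *: pos_part (x i w - k) + v w))].
  by move=> i; apply: properness_shave => //; case: xfeas.
pose r' := \big[Num.min/1]_i r i.
exists v, (r' / 2); split=> [|i|i w|i s k s0 k0 skr].
- by rewrite divr_gt0//; apply: lt_bigmin => // i _; case: (vrP i).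
- by case: (vrP i).
- by case: (vrP i).
have [_ _ _] := vrP i; apply=> //.
have : r' <= r i by exact: bigmin_le.
by move: skr; rewrite -mulrA; lra.
Qed.

(** The trade [\sum_i v i - a] stays in the cone when perturbed, within the
    ideal, by less than [r] in norm.  Were some [c] of the cone closer than
    [r] to the opposite trade, [- c] would be such a perturbation, and [c] and
    [- c] would add up to a self-financing improvement, with non-zero weights
    because those of [- c] are all [s + 1 > 0]. *)
Lemma improving_cone_far : exists v (r : R),
  [/\ 0 < r, forall i, pref E i (x i) (v i), forall i w, K (v i w) &
   forall c, improving_cone c ->
     r <= norm1 (fun w => (\sum_i v i w - a w) + c w)].
Proof.
have [v [r [r0 vP Kv shave]]] := uniform_shave.
exists v, r; split=> // c [Kc [al [y [al0 yP yc]]]].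
rewrite leNgt; apply/negP => cr.
pose k w := (\sum_i v i w - a w) + c w.
(* constant in the state, so shaving it off respects every information *)
pose kbar := \sum_w labs (k w).
have Kk w : K (k w).
  apply: idealD (Kc w) => //; apply: idealB => //; last exact: ideal_total_endow.
  exact: ideal_sum.
have kbar0 : 0 <= kbar by apply: bl_sumr_ge0 => w _; exact: labs_ge0.
have kle w : k w <= kbar.
  rewrite /kbar (bigD1 w)//= -[leLHS]addr0; apply: bl_lerD; first exact: labs_ge.
  by apply: bl_sumr_ge0 => w' _; exact: labs_ge0.
have kbarr : `|kbar| < r.
  apply: le_lt_trans (ler_norm_sum _ _ _) _; apply: le_lt_trans cr.
  by apply: ler_sum => w _; rewrite norm_labs.
have Kkbar : K kbar by apply: ideal_sum => // w _; exact: ideal_labs.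
have /choice[m mP] : forall w, exists m : R, 0 <= m /\ kbar <= m *: a w.
  move=> w; have : principal_ideal (a w) kbar by rewrite aK.
  move/(idealP (total_endow_ge0 w)) => [m m0]; rewrite labs_id// => h.
  by exists m.
(* [s] is large enough for [kap], the share of [kbar] taken from each plan, to
   lie below the total endowment in every state *)
pose s := 1 + \sum_w m w.
have ms w : m w <= s.
  rewrite /s (bigD1 w)//= addrCA lerDl addr_ge0// sumr_ge0// => w' _.
  by case: (mP w').
have s0 : 0 < s by rewrite ltr_wpDr// sumr_ge0// => w _; case: (mP w).
have s10 : 0 < s + 1 by rewrite addr_gt0.
pose kap := s^-1 *: kbar.
have kap0 : 0 <= kap by apply: bl_scaler_ge0 => //; rewrite invr_ge0 ltW.
have skap : s *: kap = kbar by rewrite scalerA divff ?gt_eqF// scale1r.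
have kapr : s * `|kap| < r.
  by rewrite -[s]gtr0_norm// -normrZ skap.
have kapa w : kap <= a w.
  have h : 0 <= s^-1 by rewrite invr_ge0 ltW.
  rewrite -[leRHS]scale1r -(mulVf (lt0r_neq0 s0)) -scalerA.
  apply: bl_ler_wpZ => //; have [m0 mk] := mP w; apply: le_trans mk _.
  by apply: bl_scaler_le => //; exact: total_endow_ge0.
pose z i w := (s + 1)^-1 *: (s *: pos_part (x i w - kap) + v i w).
have zP i : pref E i (x i) (z i) by apply: shave => //; exact: ltW.
have zE w : \sum_i (s + 1) *: (z i w - endow E i w) <= - c w.
  have -> : \sum_i (s + 1) *: (z i w - endow E i w) =
      s *: \sum_i pos_part (x i w - kap) + \sum_i v i w - (s + 1) *: a w.
    rewrite !scaler_sumr -big_split -sumrB; apply: eq_bigr => i _ /=.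
    by rewrite scalerBr /z scalerA divff ?gt_eqF// scale1r.
  apply: (@le_trans _ _ (s *: (a w - kap) + \sum_i v i w - (s + 1) *: a w)).
    apply/bl_lerD2r/bl_lerD2r/bl_ler_wpZ; first exact: ltW.
    have [xp xa] := xfeas; apply: pos_partB_sum => // i.
    by have [] := xp i.
  have -> : s *: (a w - kap) + \sum_i v i w - (s + 1) *: a w =
      \sum_i v i w - a w - kbar.
    rewrite scalerBr skap scalerDl scale1r opprD addrACA.
    by rewrite [s *: _ - kbar - _]addrAC subrr add0r addrC.
  by rewrite bl_lerBlDr [leRHS]addrC bl_lerBrDr; exact: kle.
have [u uP uE] := weights_comb al0 yP (fun=> ltW s10) zP.
have := no_improvement (fun i => addr_ge0 (al0 i) (ltW s10)) uP.
have h w : \sum_i (al i + (s + 1)) *: (u i w - endow E i w) <= 0.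
  by rewrite uE -[leRHS](subrr (c w)); exact: bl_lerD (yc w) (zE w).
move=> /(_ h ord0) /eqP; rewrite gt_eqF// ltr_wpDl//.
Qed.

Lemma improving_cone_pos c : (forall w, K (c w)) -> (forall w, 0 <= c w) ->
  improving_cone c.
Proof.
move=> Kc c0; have [v [_ [_ vP _ _]]] := uniform_shave.
split=> //; exists (fun=> 0), v; split=> // w.
by rewrite big1// => i _; rewrite scale0r.
Qed.

Lemma improving_cone_pref i z : pref E i (x i) z -> (forall w, K (z w)) ->
  improving_cone (fun w => z w - endow E i w).
Proof.
move=> zP Kz; have [v [_ [_ vP _ _]]] := uniform_shave.
split=> [w|]; first by apply: idealB => //; exact: ideal_endow.
exists (fun j => (j == i)%:R), (fun j => if j == i then z else v j).
split=> [j|j|w]; first by [].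
  by case: eqP => [->|_].
rewrite (bigD1 i)//= eqxx scale1r big1 ?addr0// => j /negbTE ->.
by rewrite scale0r.
Qed.

(** The distance of [- z] to the improving cone. *)
Definition cone_dist z : R :=
  inf [set norm1 (fun w => z w + c w) | c in improving_cone].

Lemma cone_dist_has_inf z :
  has_inf [set norm1 (fun w => z w + c w) | c in improving_cone].
Proof.
split; last by exists 0 => _ [c _ <-]; exact: norm1_ge0.
exists (norm1 (fun w => z w + 0)), (fun=> 0) => //.
by apply: improving_cone_pos => // w; exact: ideal0.
Qed.

Lemma cone_dist_le z c : improving_cone c ->
  cone_dist z <= norm1 (fun w => z w + c w).
Proof.
by move=> Cc; apply: ge_inf; [exact: (cone_dist_has_inf z).2|exists c].
Qed.

Lemma cone_dist_ge z (m : R) :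
  (forall c, improving_cone c -> m <= norm1 (fun w => z w + c w)) ->
  m <= cone_dist z.
Proof.
move=> h; apply: lb_le_inf; first exact: (cone_dist_has_inf z).1.
by move=> _ [c Cc <-]; exact: h.
Qed.

Lemma cone_dist_le_norm1 z : cone_dist z <= norm1 z.
Proof.
apply: le_trans (@cone_dist_le z (fun=> 0) _) _.
  by apply: improving_cone_pos => // w; exact: ideal0.
by apply: ler_sum => w _; rewrite addr0.
Qed.

Lemma cone_dist_opp c : improving_cone c -> cone_dist (- c) <= 0.
Proof.
move=> Cc; apply: le_trans (cone_dist_le _ Cc) _.
by rewrite /norm1 big1// => w _; rewrite addNr normr0.
Qed.

Lemma cone_dist_sublinear : sublinear (cone_dist : (Omega -> Y) -> R).
Proof.
split=> [z z'|l z].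
  rewrite -lerBlDr; apply: cone_dist_ge => c Cc.
  rewrite lerBlDl -lerBlDr; apply: cone_dist_ge => c' Cc'.
  rewrite lerBlDr; apply: le_trans (cone_dist_le _ (improving_coneD Cc Cc')) _.
  apply: le_trans (norm1D _ _); apply: ler_sum => w _.
  by rewrite [X in _ <= `|X|]addrC addrACA.
rewrite le_eqVlt => /predU1P[<-|l0].
  rewrite scale0r mul0r; apply: le_trans (cone_dist_le_norm1 0) _.
  by rewrite /norm1 big1// => w _; rewrite normr0.
rewrite -ler_pdivrMl//; apply: cone_dist_ge => c Cc; rewrite ler_pdivrMl//.
apply: le_trans (cone_dist_le _ (improving_coneZ (ltW l0) Cc)) _.
rewrite -[l in leRHS]gtr0_norm// -norm1Z; apply: ler_sum => w _.
by rewrite scalerDr.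
Qed.

Definition at_state w (u : Y) : Omega -> Y := fun w' => if w' == w then u else 0.

Lemma sum_at_state z : z = \sum_w at_state w (z w).
Proof.
apply/funext => w; rewrite fct_sumE (bigD1 w)//= /at_state eqxx.
by rewrite big1 ?addr0// => w' /negbTE; rewrite eq_sym => ->.
Qed.

Lemma norm1_at_state w (u : Y) : norm1 (at_state w u) = `|u|.
Proof.
rewrite /norm1 (bigD1 w)//= /at_state eqxx big1 ?addr0// => w' /negbTE ->.
by rewrite normr0.
Qed.

(** Prices are the coordinates of a linear functional below [cone_dist].
    Domination by the norm makes it continuous; as [cone_dist] is at most [0]
    on the opposite of the cone, it is non-negative on the cone; and touching
    [cone_dist] at the trade of [improving_cone_far] makes it non-zero.
    Positivity and support, first known inside the ideal, extend by
    density. *)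
Lemma exists_supporting_price : exists pi : Omega -> {linear Y -> R^o},
  [/\ forall w, pos_dual Y (pi w),
      forall i z, pref E i (x i) z -> value pi (endow E i) <= value pi z &
      exists2 z, forall w, K (z w) & 0 < value pi z].
Proof.
have [v [r [r0 vP Kv vfar]]] := improving_cone_far.
pose u w := \sum_i v i w - a w.
have [l [lq lu]] := hahn_banach u cone_dist_sublinear.
have l_le z : l z <= norm1 z := le_trans (lq z) (cone_dist_le_norm1 z).
have l_norm z : `|l z| <= norm1 z.
  rewrite ler_norml l_le andbT lerNl -linearN (le_trans (l_le _))//.
  by apply: ler_sum => w _; rewrite normrN.
have l_cone c : improving_cone c -> 0 <= l c.
  move=> Cc; rewrite -oppr_le0 -linearN.
  exact: le_trans (lq _) (cone_dist_opp Cc).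
have pl w : linear ((fun y => l (at_state w y)) : Y -> R^o).
  move=> k y y'; rewrite -linearP; congr (l _); apply/funext => w'.
  rewrite [RHS](_ : _ = k *: at_state w y w' + at_state w y' w')//.
  by rewrite /at_state; case: ifP => // _; rewrite scaler0 addr0.
pose pi w : {linear Y -> R^o} :=
  HB.pack ((fun y => l (at_state w y)) : Y -> R^o)
    (GRing.isLinear.Build R Y R^o *:%R _ (pl w)).
have piE w y : pi w y = l (at_state w y) by [].
have valueE z : value pi z = l z.
  by rewrite [in RHS](sum_at_state z) linear_sum.
have value_close z z' : value pi z - value pi z' <= norm1 (fun w => z w - z' w).
  by rewrite !valueE -linearB; exact: l_le.
have cont w : continuous (pi w : Y -> R^o).
  move=> y; apply/cvgrPdist_lt => eps eps0; near=> y'.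
  rewrite -linearB piE (le_lt_trans (l_norm _))// norm1_at_state.
  by near: y'; exact: cvgr_dist_lt.
exists pi; split=> [w|i z zP|].
- split=> // y y0; apply/ler_addgt0Pr => eps eps0.
  have [y' [Ky' y'0 y'y]] := ideal_approx dK y0 eps0.
  have Cy' : improving_cone (at_state w y').
    apply: improving_cone_pos => w'; rewrite /at_state; case: ifP => // _.
    exact: ideal0.
  have := l_cone _ Cy'; rewrite -piE -(subrK y y') linearD => h.
  apply: le_trans h _; rewrite addrC lerD2l piE (le_trans (l_le _))//.
  by rewrite norm1_at_state ltW.
- apply/ler_addgt0Pr => eps eps0.
  have [d d0 dP] := pref_open continuity zP.
  have [zi _] := zP.
  pose eps' := eps / (#|Omega|%:R + 1).
  have N0 : 0 < #|Omega|%:R + 1 :> R by rewrite ltr_wpDl.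
  have eps'0 : 0 < eps' by rewrite divr_gt0.
  have m0 : 0 < Num.min d eps' by rewrite lt_min d0.
  have [z' [z'i Kz' z'z]] := plans_approx dK zi m0.
  have z'P : pref E i (x i) z'.
    by apply: dP => // w; apply: lt_le_trans (z'z w) _; rewrite ge_min lexx.
  have := l_cone _ (improving_cone_pref z'P Kz').
  rewrite (_ : (fun _ => _) = z' - endow E i)// linearB -!valueE subr_ge0 => h.
  apply: le_trans h _; rewrite -lerBlDl; apply: le_trans (value_close _ _) _.
  apply: (@le_trans _ _ (\sum_(w : Omega) eps')).
    apply: ler_sum => w _; apply: le_trans (ltW (z'z w)) _.
    by rewrite ge_min lexx orbT.
  rewrite sumr_const -mulr_natl /eps' mulrCA ler_piMr// ?(ltW eps0)//.
  by rewrite ler_pdivrMr// mul1r lerDl.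
- exists u => [w|]; last first.
    by rewrite valueE lu; apply: lt_le_trans r0 _; exact: cone_dist_ge.
  apply: idealB => //; last exact: ideal_total_endow.
  exact: ideal_sum.
Unshelve. all: by end_near. Qed.

End supporting_price.

(** * Quasi-equilibrium *)

Section value.
Context {R : realType} {Y : banachLatticeType R} {Omega : finType}.
Context {p : Omega -> {linear Y -> R^o}}.
Implicit Types (z y : Omega -> Y).

Lemma valueD z y : value p (fun w => z w + y w) = value p z + value p y.
Proof. by rewrite -big_split; apply: eq_bigr => w _; rewrite linearD. Qed.

Lemma valueZ (l : R) z : value p (fun w => l *: z w) = l * value p z.
Proof. by rewrite mulr_sumr; apply: eq_bigr => w _; rewrite linearZ. Qed.

Lemma value_sum (I : finType) (z : I -> Omega -> Y) :
  value p (fun w => \sum_i z i w) = \sum_i value p (z i).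
Proof.
by rewrite exchange_big; apply: eq_bigr => w _; rewrite linear_sum.
Qed.

Context (p_pos : forall w, pos_dual Y (p w)).

Lemma pos_dual_le w (u v : Y) : u <= v -> p w u <= p w v :> R.
Proof.
move=> uv; rewrite -subr_ge0 -linearB; have [_] := p_pos w; apply.
by rewrite bl_subr_ge0.
Qed.

Lemma value_ge0 z : (forall w, 0 <= z w) -> 0 <= value p z.
Proof.
by move=> z0; apply: sumr_ge0 => w _; have [_] := p_pos w; exact.
Qed.

Lemma value_le z y : (forall w, z w <= y w) -> value p z <= value p y.
Proof. by move=> zy; apply: ler_sum => w _; exact: pos_dual_le. Qed.

End value.

Section supported_allocation.
Context {R : realType} {Y : banachLatticeType R} {Omega : finType} {n : nat}.
Context {E : economy Y Omega n}.
Context (continuity : forall i w, {within pos_cone Y, continuous (util E i w)}).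
Context (concavity : forall i w, concave_on (pos_cone Y) (util E i w)).
Context {p : Omega -> {linear Y -> R^o}}.
Context (p_pos : forall w, pos_dual Y (p w)).
Context {x : 'I_n.+1 -> Omega -> Y}.
Context (support : forall i z, pref E i (x i) z ->
  value p (endow E i) <= value p z).
Implicit Types (i : 'I_n.+1) (z v : Omega -> Y).

(** [x i] is the limit of the preferred plans on the segment to [v]. *)
Lemma supported_le i v : plans E i (x i) -> pref E i (x i) v ->
  value p (endow E i) <= value p (x i).
Proof.
move=> xi vP; rewrite leNgt; apply/negP => xa.
set g := value p (endow E i) - value p (x i).
pose D := value p v - value p (x i).
have g0 : 0 < g by rewrite subr_gt0.
have gD : g <= D by rewrite lerD2r; exact: support.
have D0 : 0 < D := lt_le_trans g0 gD.
have seg (t : R) : 0 < t -> t <= 1 -> g <= t * D.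
  move=> t0 t1; have h0 : 0 <= 1 - t by rewrite subr_ge0.
  have h1 : 1 - t < 1 by rewrite ltrBlDr ltrDl.
  have := support (pref_segment concavity h0 h1 xi vP).
  by rewrite valueD !valueZ /g /D; lra.
have := seg (g / (2 * D)) _ _; rewrite divr_gt0 ?mulr_gt0//.
rewrite ler_pdivrMr ?mulr_gt0// mul1r => /(_ isT) h.
have : g <= g / (2 * D) * D by apply: h; lra.
have -> : g / (2 * D) * D = g / 2 by field; rewrite gt_eqF.
by lra.
Qed.

(** No [x i] is worth less than the endowment of [i], and by feasibility the
    total is not worth more, so there is equality type by type. *)
Lemma supported_eq : feasible_allocation E x ->
  (forall i, exists v, pref E i (x i) v) ->
  forall i, value p (x i) = value p (endow E i).
Proof.
move=> [xplan xa] nonsat.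
have le i : value p (endow E i) <= value p (x i).
  by have [v vP] := nonsat i; exact: supported_le (xplan i) vP.
have := value_le p_pos xa; rewrite !value_sum => sle i.
apply/eqP; rewrite eq_le le andbT leNgt; apply/negP => lti.
suff : \sum_i value p (endow E i) < \sum_i value p (x i) by rewrite ltNge sle.
rewrite (bigD1 i)//= [ltRHS](bigD1 i)//=; apply: ltr_leD => //.
by apply: ler_sum => j _.
Qed.

(** A preferred affordable plan, scaled down slightly, would be preferred and
    worth less than the endowment. *)
Lemma supported_maximal i z : value p (endow E i) != 0 ->
  budget E p i z -> ex_ante E i z <= ex_ante E i (x i).
Proof.
move=> ai0 [zi za]; rewrite leNgt; apply/negP => xz.
have ai : 0 < value p (endow E i).
  rewrite lt_neqAle eq_sym ai0 value_ge0// => w; exact: endow_ge0.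
have [d d0 dP] := pref_open continuity (conj zi xz).
have M0 : 0 < 1 + \sum_w `|z w| by rewrite ltr_wpDr// sumr_ge0.
pose t := Num.min (1 / 2) (d / (1 + \sum_w `|z w|)).
have t0 : 0 < t by rewrite lt_min !divr_gt0.
have t1 : t <= 1 / 2 by rewrite ge_min lexx.
have tM : t * (1 + \sum_w `|z w|) <= d.
  by rewrite -ler_pdivlMr// ge_min lexx orbT.
have : pref E i (x i) (fun w => (1 - t) *: z w).
  apply: dP => [|w].
    have [z0 zc] := zi; split=> [w|A iA w w' wA w'A].
      by apply: bl_scaler_ge0 => //; lra.
    by rewrite (zc _ iA _ _ wA w'A).
  rewrite scalerBl scale1r addrAC subrr add0r normrN normrZ gtr0_norm//.
  apply: lt_le_trans tM; rewrite ltr_pM2l//.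
  rewrite (bigD1 w)//= addrCA ltrDl ltr_wpDr// sumr_ge0//.
by move=> /support; rewrite valueZ; nra.
Qed.

End supported_allocation.

Unset Implicit Arguments.

Theorem theorem3p7 (R : realType) (Y : banachLatticeType R) (Omega : finType)
  (n : nat) (E : economy Y Omega n)
  (continuity : forall i w, {within pos_cone Y, continuous (util E i w)})
  (monotonicity : forall i w (x y : Y), 0 <= x -> 0 < y ->
     util E i w (x + y) > util E i w x)
  (concavity : forall i w, concave_on (pos_cone Y) (util E i w))
  (quasi_interiority : forall w, quasi_interior (\sum_i endow E i w))
  (stability : exists2 a : Y, 0 <= a &
     forall w, principal_ideal (\sum_i endow E i w) = principal_ideal a)
  (properness : forall x, privately_pareto_optimal E x ->
     forall i, ATY_proper E i (x i))
  (f : R -> Omega -> Y) (x : 'I_n.+1 -> Omega -> Y)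
  (f_feasible : feasible_allocation_c E f)
  (f_step : forall i t, type_block i t -> f t = x i)
  (f_core : private_core E f) :
  exists pi : Omega -> {linear Y -> R^o},
    quasi_equilibrium E f pi /\ nontrivial_prices E pi.
Proof.
have [e e0 aK] := stability.
have proper := properness _ (core_pareto_optimal f_step f_core).
have xfeas := feasible_step f_step f_feasible.
have [xp xa] := xfeas.
have dK : dense (principal_ideal e).
  have [w _] : exists w : Omega, true.
    apply: contrapT => h; have := @prior_sum1 _ _ _ _ E ord0.
    rewrite big1 => [/eqP|w _]; first by rewrite eq_sym oner_eq0.
    by exfalso; apply: h; exists w.
  by rewrite -(aK w); have [_] := quasi_interiority w.
have [pi [pi_pos support [z Kz z0]]] := exists_supporting_price continuity
  concavity e0 dK aK xfeas
  (fun alpha y => core_no_improvement f_step f_core) proper.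
have nonsat i : exists v, pref E i (x i) v.
  have [Pt [_ _ <- [v [/interior_subset Pv vi]]]] := proper i.
  by exists v.
have xaE := supported_eq concavity pi_pos support xfeas nonsat.
exists pi; split; last first.
  (* a zero value of all endowments would make the prices vanish on the ideal
     of the total endowment *)
  have [i ai] : exists i, value pi (endow E i) != 0.
    apply: contrapT => h.
    have a0 w : pi w (\sum_i endow E i w) = 0.
      have pos w' : 0 <= pi w' (\sum_i endow E i w') :> R.
        by have [_] := pi_pos w'; apply; exact: total_endow_ge0.
      have : value pi (fun w => \sum_i endow E i w) = 0.
        rewrite value_sum big1// => i _.
        by apply: contrapT => /eqP ai; apply: h; exists i.
      by move=> /psumr_eq0P -> //.
    move: z0; rewrite ltNge => /negP; apply; apply: sumr_le0 => w _.
    have := Kz w; rewrite -(aK w) => /(idealP (total_endow_ge0 w))[c c0 zc].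
    have := pos_dual_le pi_pos w (le_trans (labs_ge _) zc).
    by rewrite linearZ /= a0 scaler0.
  exists (type_block i) => [|t it]; last by rewrite (endow_c_step it).
  split; [exact: measurable_type_block|exact: block_sub_agent_space|].
  by rewrite measure_type_block lte_fin invr_gt0.
split; [exact: f_feasible| | |].
- split=> //; apply: contrapT => h; move: z0; rewrite /value big1 ?ltxx// => w _.
  by apply: contrapT => /eqP zw; apply: h; exists w, (z w).
- move=> t; rewrite /agent_space /= in_itv => /type_block_agent_type it.
  rewrite /budget_c /ex_ante_c /endow_c (f_step _ _ (it n)).
  split; first by split=> //; rewrite xaE.
  by move=> ai z'; exact: supported_maximal.
under [in LHS]eq_fun do rewrite (integral_step f_step).
under [in RHS]eq_fun do rewrite integral_endow.
rewrite !valueZ !value_sum; congr (_ * _); exact: eq_bigr.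
Qed.
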